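(* Let $m,n\ge1$ be integers, let $\boldsymbol{\Sigma}>\mathbf{0}$ be $m\times m$, let $\boldsymbol{\Theta}>\mathbf{0}$ be $n\times n$, and let $\boldsymbol{\mu}$ be a real $n\times m$ matrix. Let $\upsilon>0$, $\xi>0$, let $a_1,\dots,a_p,b_1,\dots,b_q$ be real or complex constants and let $\operatorname{Re}(a)>0$. Suppose that the positive random variable $s$ has an inverted hypergeometric gamma type distribution, i.e. its density function is $$g_S(s)=\frac{\xi^{a}}{\Gamma[a]\;{}_{p+1}F_q\left(a_1,\dots,a_p,a;b_1,\dots,b_q;\frac{\upsilon}{\xi}\right)}\,\exp\left\{-\frac{\xi}{s}\right\}s^{-a-1}\;{}_pF_q\left(a_1,\dots,a_p;b_1,\dots,b_q;\frac{\upsilon}{s}\right),\quad s>0,$$ and that, conditionally on $s$, the random matrix $\mathbf{X}$ has the matrix variate normal distribution $$\mathbf{X}\mid s\sim\mathcal{N}_{m\times n}(\boldsymbol{\mu},s\boldsymbol{\Sigma},\boldsymbol{\Theta}).$$ Then $\mathbf{X}$ has a matrix variate left-spherical elliptical distribution, with density function $$\frac{\Gamma[a+mn/2]\,\xi^{a}}{(2\pi)^{mn/2}\,\Gamma[a]\,|\boldsymbol{\Sigma}|^{n/2}|\boldsymbol{\Theta}|^{m/2}\;{}_{p+1}F_q\left(a_1,\dots,a_p,a;b_1,\dots,b_q;\frac{\upsilon}{\xi}\right)}\cdot\frac{{}_{p+1}F_q\left(a_1,\dots,a_p,a+\frac{mn}{2};b_1,\dots,b_q;\upsilon\left(\xi+\frac12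 t\right)^{-1}\right)}{\left(\xi+\frac12 t\right)^{a+mn/2}},$$ where $t=\operatorname{tr}\boldsymbol{\Sigma}^{-1}(\mathbf{X}-\boldsymbol{\mu})'\boldsymbol{\Theta}^{-1}(\mathbf{X}-\boldsymbol{\mu})$.
   Context: Notation: $\mathbf{A}>\mathbf{0}$ means $\mathbf{A}$ is (real symmetric) positive definite, $\mathbf{A}^{1/2}$ is its positive definite square root, $|\mathbf{A}|$ is the determinant, $\mathbf{A}'$ is the transpose, $\operatorname{etr}\{\mathbf{A}\}=\exp(\operatorname{tr}\mathbf{A})$. Densities of $\mathbf{X}$ are with respect to Lebesgue measure on real $n\times m$ matrices. $\Gamma[\cdot]$ is the usual gamma function. Here ${}_pF_q$ is the classical scalar generalized hypergeometric series $${}_pF_q(a_1,\dots,a_p;b_1,\dots,b_q;y)=\sum_{k=0}^\infty\frac{(a_1)_k\cdots(a_p)_k}{(b_1)_k\cdots(b_q)_k}\frac{y^k}{k!},\qquad (x)_k=x(x+1)\cdots(x+k-1),\ (x)_0=1.$$ It is understood that the parameters are such that the hypergeometric series occurring are well defined and convergent and that $g_S$ is a probability density. Matrix variate normal: $\mathbf{X}\sim\mathcal{N}_{m\times n}(\boldsymbol{\mu},\boldsymbol{\Sigma},\boldsymbol{\Theta})$ ($\mathbf{X}$, $\boldsymbol{\mu}$ real $n\times m$, $\boldsymbol{\Sigma}>\mathbf{0}$ of size $m\times m$, $\boldsymbol{\Theta}>\mathbf{0}$ of size $n\times n$) means that $\mathbf{X}$ has density $$\frac{1}{(2\pi)^{mn/2}|\boldsymbol{\Sigma}|^{n/2}|\boldsymbol{\Theta}|^{m/2}}\operatorname{etr}\left\{-\tfrac12\boldsymbol{\Sigma}^{-1}(\mathbf{X}-\boldsymbol{\mu})'\boldsymbol{\Theta}^{-1}(\mathbf{X}-\boldsymbol{\mu})\right\}.$$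 Matrix variate left-spherical elliptical distribution: $\mathbf{X}$ has density of the form $\frac{c(m,n)}{|\boldsymbol{\Sigma}|^{n/2}|\boldsymbol{\Theta}|^{m/2}}h\left(\boldsymbol{\Sigma}^{-1/2}(\mathbf{X}-\boldsymbol{\mu})'\boldsymbol{\Theta}^{-1}(\mathbf{X}-\boldsymbol{\mu})\boldsymbol{\Sigma}^{-1/2}\right)$ for a real function $h$ and a normalization constant $c(m,n)$. *)

(* Defs.v *)
From HB Require Import structures.
From mathcomp Require Import all_boot all_order all_algebra complex.
From mathcomp Require Import all_classical all_reals all_analysis.

Set Implicit Arguments.
Unset Strict Implicit.
Unset Printing Implicit Defensive.

Import Order.TTheory GRing.Theory Num.Theory.
Import numFieldNormedType.Exports.

Local Open Scope classical_set_scope.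
Local Open Scope ring_scope.

Section matrix_measurable.
Context (R : realType) (n m : nat).

Let coords (k : 'I_(n * m)) (A : 'M[R]_(n, m)) : measurableTypeR R :=
  mxvec A 0 k.

Let mx_set0 : g_sigma_preimage coords set0.
Proof. exact: sigma_algebra0. Qed.

Let mx_setC A : g_sigma_preimage coords A -> g_sigma_preimage coords (~` A).
Proof. exact: sigma_algebraC. Qed.

Let mx_bigcup (F : (set _)^nat) : (forall i, g_sigma_preimage coords (F i)) ->
  g_sigma_preimage coords (\bigcup_i (F i)).
Proof. exact: sigma_algebra_bigcup. Qed.

(* The product (equivalently Borel) sigma-algebra, generated by the entries. *)
HB.instance Definition _ := @isMeasurable.Build
  (measure_tuple_display (R.-ocitv.-measurable).-sigma)
  'M[R]_(n, m) (g_sigma_preimage coords) mx_set0 mx_setC mx_bigcup.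

Definition mx_of_tuple (t : (n * m).-tuple (measurableTypeR R)) : 'M[R]_(n, m) :=
  vec_mx (\row_k tnth t k).

Definition tuple_of_mx (A : 'M[R]_(n, m)) : (n * m).-tuple (measurableTypeR R) :=
  [tuple mxvec A 0 k | k < n * m].

Lemma mx_of_tupleK : cancel mx_of_tuple tuple_of_mx.
Proof.
move=> t; apply: eq_from_tnth => k.
by rewrite tnth_mktuple vec_mxK mxE.
Qed.

Lemma tuple_of_mxK : cancel tuple_of_mx mx_of_tuple.
Proof.
move=> A; rewrite /mx_of_tuple -[RHS]mxvecK; congr vec_mx.
by apply/rowP => k; rewrite mxE tnth_mktuple.
Qed.

Lemma measurable_mx_of_tuple : measurable_fun setT mx_of_tuple.
Proof.
apply: (@measurability _ _ _ _ _ _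
  (\big[setU/set0]_(i < n * m) preimage_set_system setT (coords i) measurable)).
- by [].
move=> _ [B + <-]; rewrite -bigcup_seq/= => -[k _ [C mC <-]].
rewrite !setTI -comp_preimage.
have -> : coords k \o mx_of_tuple = (@tnth _ (measurableTypeR R) ^~ k).
  by apply/funext => t /=; rewrite /coords vec_mxK mxE.
by rewrite -[X in measurable X]setTI; exact: measurable_tnth.
Qed.

Lemma measurable_tuple_of_mx : measurable_fun setT tuple_of_mx.
Proof.
apply/measurable_fun_tnthP => k.
have -> : (@tnth _ (measurableTypeR R) ^~ k) \o tuple_of_mx = coords k.
  by apply/funext => A /=; rewrite tnth_mktuple.
move=> _ Y mY; rewrite setTI; apply: sub_sigma_algebra => /=.
rewrite -bigcup_seq/=; exists k => /=; first by rewrite mem_index_enum.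
by exists Y => //; rewrite setTI.
Qed.

End matrix_measurable.

Section pushforward_sigma_finite.
Context d1 d2 (T1 : measurableType d1) (T2 : measurableType d2) (R : realType).

Lemma sigma_finite_pushforward (mu : set T1 -> \bar R)
    (f : T1 -> T2) (g : T2 -> T1) :
  sigma_finite setT mu -> measurable_fun setT g -> cancel f g ->
  sigma_finite setT (pushforward mu f).
Proof.
move=> [F FT Foo] mg fK.
exists (fun i => g @^-1` F i) => [|i].
  by rewrite -preimage_bigcup -FT preimage_setT.
have [mF Fi] := Foo i; split; first by rewrite -[X in measurable X]setTI; apply: mg.
by rewrite /pushforward -comp_preimage (_ : g \o f = id)//; apply/funext.
Qed.

(* The library's sigma-finite instance on [\x] is shadowed by the one for
   subprobability measures, hence this copy. *)
Lemma sigma_finite_product (m1 : {sigma_finite_measure set T1 -> \bar R})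
    (m2 : {sigma_finite_measure set T2 -> \bar R}) :
  sigma_finite setT (m1 \x m2)%E.
Proof.
have /sigma_finiteP[F [TF ndF Foo]] := sigma_finiteT m1.
have /sigma_finiteP[G [TG ndG Goo]] := sigma_finiteT m2.
exists (fun n => F n `*` G n).
  rewrite -setXTT TF TG predeqE => -[x y]; split.
    move=> [/= [n _ Fnx] [k _ Gky]]; exists (maxn n k) => //; split.
    - by move: x Fnx; exact/subsetPset/ndF/leq_maxl.
    - by move: y Gky; exact/subsetPset/ndG/leq_maxr.
  by move=> [n _ []/= ? ?]; split; exists n.
move=> k; have [? ?] := Foo k; have [? ?] := Goo k.
split; first exact: measurableX.
by rewrite product_measure1E// lte_mul_pinfty// ge0_fin_numE.
Qed.

End pushforward_sigma_finite.

Section lebesgue_tuple.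
Context (R : realType).

Section cons.
Variables (n : nat) (nu : {sigma_finite_measure set (n.-tuple (measurableTypeR R)) -> \bar R}).

Let consp (p : measurableTypeR R * n.-tuple (measurableTypeR R)) : n.+1.-tuple (measurableTypeR R) := [tuple of p.1 :: p.2].
Let unconsp (t : n.+1.-tuple (measurableTypeR R)) : measurableTypeR R * n.-tuple (measurableTypeR R) :=
  (thead t, [tuple of behead t]).

Let mconsp : measurable_fun setT consp.
Proof. exact: measurable_cons. Qed.

Let munconsp : measurable_fun setT unconsp.
Proof.
apply: measurable_fun_pair; [exact: measurable_tnth|exact: measurable_behead].
Qed.

Let conspK : cancel consp unconsp.
Proof.
by move=> [x t]; rewrite /unconsp /consp /= theadE; congr pair; exact/val_inj.
Qed.

Definition cons_measure : set (n.+1.-tuple (measurableTypeR R)) -> \bar R :=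
  pushforward (@lebesgue_measure R \x nu)%E consp.

Let cons_measure0 : cons_measure set0 = 0%E.
Proof. by rewrite /cons_measure /pushforward preimage_set0 measure0. Qed.

Let cons_measure_ge0 A : (0 <= cons_measure A)%E.
Proof. exact: measure_ge0. Qed.

Let cons_measure_sigma_additive : semi_sigma_additive cons_measure.
Proof. by apply: measure_semi_sigma_additive; exact: mconsp. Qed.

HB.instance Definition _ := isMeasure.Build _ _ _ cons_measure
  cons_measure0 cons_measure_ge0 cons_measure_sigma_additive.

Let cons_measure_sigma_finite : sigma_finite setT cons_measure.
Proof.
exact: (sigma_finite_pushforward (sigma_finite_product _ _) munconsp conspK).
Qed.

HB.instance Definition _ := Measure_isSigmaFinite.Build _ _ _ cons_measure
  cons_measure_sigma_finite.

End cons.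

Fixpoint lebesgue_tuple n : {sigma_finite_measure set (n.-tuple (measurableTypeR R)) -> \bar R} :=
  match n with
  | 0 => dirac [tuple]
  | n'.+1 => cons_measure (lebesgue_tuple n')
  end.

Lemma lebesgue_tuple_box n (A : 'I_n -> set (measurableTypeR R)) :
  (forall i, measurable (A i)) ->
  lebesgue_tuple n [set t | forall i, A i (tnth t i)] =
  (\prod_(i < n) @lebesgue_measure R (A i))%E.
Proof.
elim: n A => [|n IH] A mA.
  by rewrite big_ord0 /= diracE mem_set// => -[].
rewrite big_ord_recl/= /cons_measure /pushforward/=.
rewrite -(IH (fun i => A (lift ord0 i)))//.
rewrite -product_measure1E//; last first.
  rewrite (_ : [set _ | _] = \big[setI/setT]_(i < n)
      ((@tnth n (measurableTypeR R) ^~ i) @^-1` A (lift ord0 i))).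
    apply: bigsetI_measurable => i _.
    rewrite -[X in measurable X]setTI.
    by apply: measurable_tnth => //; exact: mA.
  apply/seteqP; split=> [t /= At|t /=]; first by rewrite -bigcap_seq => i _.
  by rewrite -bigcap_seq => /(_ _) At i; exact: (At i (mem_index_enum i)).
congr product_measure1; apply/seteqP; split=> [[x t]/= At|[x t] [/= Ax At]].
  by split=> [|i]; [have := At ord0|have := At (lift ord0 i); rewrite tnthS].
by move=> i; case: (unliftP ord0 i) => [j|] ->; rewrite ?tnthS.
Qed.

End lebesgue_tuple.

Section lebesgue_mx.
Context (R : realType) (n m : nat).

Definition lebesgue_mx : set 'M[R]_(n, m) -> \bar R :=
  pushforward (lebesgue_tuple R (n * m)) (@mx_of_tuple R n m).

Let lebesgue_mx0 : lebesgue_mx set0 = 0%E.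
Proof. by rewrite /lebesgue_mx /pushforward preimage_set0 measure0. Qed.

Let lebesgue_mx_ge0 A : (0 <= lebesgue_mx A)%E.
Proof. by rewrite /lebesgue_mx /pushforward; exact: measure_ge0. Qed.

Let lebesgue_mx_sigma_additive : semi_sigma_additive lebesgue_mx.
Proof.
by apply: measure_semi_sigma_additive; exact: measurable_mx_of_tuple.
Qed.

HB.instance Definition _ := isMeasure.Build _ _ _ lebesgue_mx
  lebesgue_mx0 lebesgue_mx_ge0 lebesgue_mx_sigma_additive.

Let lebesgue_mx_sigma_finite : sigma_finite setT lebesgue_mx.
Proof.
exact: (sigma_finite_pushforward (sigma_finiteT _) (@measurable_tuple_of_mx R n m)
  (@mx_of_tupleK R n m)).
Qed.

HB.instance Definition _ := Measure_isSigmaFinite.Build _ _ _ lebesgue_mx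
  lebesgue_mx_sigma_finite.

Lemma lebesgue_mx_box (A : 'I_n -> 'I_m -> set (measurableTypeR R)) :
  (forall i j, measurable (A i j)) ->
  lebesgue_mx [set M | forall i j, A i j (M i j)] =
  (\prod_(i < n) \prod_(j < m) @lebesgue_measure R (A i j))%E.
Proof.
move=> mA; rewrite pair_big/=.
pose p (k : 'I_(n * m)) : 'I_n * 'I_m :=
  enum_val (cast_ord (esym (mxvec_cast n m)) k).
rewrite (reindex p)/=; last first.
  exists (fun p => mxvec_index p.1 p.2) => [k _|[i j] _].
    rewrite /p; case: (mxvec_indexP k) => i j.
    by rewrite /mxvec_index cast_ordK enum_rankK.
  by rewrite /p /mxvec_index cast_ordK enum_rankK.
rewrite -(lebesgue_tuple_box (A := fun k => A (p k).1 (p k).2))//.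
rewrite /lebesgue_mx /pushforward; congr (lebesgue_tuple _ _ _).
have pE i j : p (mxvec_index i j) = (i, j).
  by rewrite /p /mxvec_index cast_ordK enum_rankK.
have mxE' t i j : mx_of_tuple t i j = tnth t (mxvec_index i j).
  by rewrite /mx_of_tuple mxE mxE.
apply/seteqP; split=> [t /= At k|t /= At i j].
  by case: (mxvec_indexP k) => i j; rewrite pE -mxE'; exact: At.
by rewrite mxE'; have := At (mxvec_index i j); rewrite pE.
Qed.

End lebesgue_mx.

Section complex_special_functions.
Local Open Scope complex_scope.
Context {R : realType}.
Implicit Types (x : R) (z a y : R[i]) (k : nat) (A B : seq R[i]).

Definition expC z : R[i] :=
  (expR (complex.Re z))%:C * (cos (complex.Im z) +i* sin (complex.Im z)).

(* Principal power of a positive real base; only used for [0 < x]. *)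
Definition cpow x z : R[i] := expC (z * (ln x)%:C).

(* Euler's integral; it is the gamma function for [0 < Re z], the only case
   used. *)
Definition cGamma z : R[i] :=
  let f x := cpow x (z - 1) * (expR (- x))%:C in
  (\int[lebesgue_measure]_(x in `]0, +oo[) complex.Re (f x)) +i*
  (\int[lebesgue_measure]_(x in `]0, +oo[) complex.Im (f x)).

Definition pochhammer z k : R[i] := \prod_(i < k) (z + i%:R).

Definition hyp_term A B y k : R[i]^o :=
  (\prod_(a <- A) pochhammer a k) / (\prod_(b <- B) pochhammer b k) *
  (y ^+ k / k`!%:R).

(* p = size A and q = size B. *)
Definition pFq A B y : R[i] := limn (series (hyp_term A B y)).

Definition hyp_well_defined B := forall b k, b \in B -> b + k%:R != 0.

Definition hyp_convergent A B y := cvgn (series (hyp_term A B y)).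

End complex_special_functions.

Section matrices.
Context {R : realType}.

Definition posdefmx k (A : 'M[R]_k) :=
  A^T = A /\ forall v : 'rV[R]_k, v != 0 -> 0 < (v *m A *m v^T) 0 0.

(* The positive definite square root A^{1/2}: it exists and is unique when A is
   positive definite. *)
Definition sqrtmx k (A : 'M[R]_k) : 'M[R]_k :=
  xget 0 [set B | posdefmx B /\ B *m B = A].

Definition etr k (A : 'M[R]_k) : R := expR (\tr A).

(* Density of N_{m x n}(mu, Sigma, Theta) at x. *)
Definition matrix_normal_pdf n m (mu : 'M[R]_(n, m)) (Sigma : 'M[R]_m)
    (Theta : 'M[R]_n) (x : 'M[R]_(n, m)) : R :=
  ((2 * pi) `^ ((m * n)%:R / 2) * (\det Sigma) `^ (n%:R / 2) *
   (\det Theta) `^ (m%:R / 2))^-1 *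
  etr (- 2^-1 *: (invmx Sigma *m (x - mu)^T *m invmx Theta *m (x - mu))).

End matrices.

Section random_variables.
Local Open Scope complex_scope.
Context {d} {Omega : measurableType d} {R : realType} (P : probability Omega R).

(* The formulas for the densities involve complex parameters. In the order of
   [R[i]], [0 <= f x] says that the value [f x] is a nonnegative real. *)
Definition has_density {d'} {T : measurableType d'} (X : {RV P >-> T})
    (nu : {measure set T -> \bar R}) (f : T -> R[i]) :=
  [/\ forall x, 0 <= f x,
      measurable_fun setT (fun x => complex.Re (f x)) &
      forall B, measurable B ->
        distribution P X B = (\int[nu]_(x in B) (complex.Re (f x))%:E)%E].

(* The conditional law of X given S = s has density [f s] with respect to nu. *)
Definition has_conditional_density {d1 d2} {T1 : measurableType d1}
    {T2 : measurableType d2} (S : {RV P >-> T1}) (X : {RV P >-> T2})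
    (nu : {measure set T2 -> \bar R}) (f : T1 -> T2 -> R) :=
  forall A B, measurable A -> measurable B ->
    P (S @^-1` A `&` X @^-1` B) =
    (\int[distribution P S]_(s in A) \int[nu]_(x in B) (f s x)%:E)%E.

Definition left_spherical_elliptical n m (mu : 'M[R]_(n, m))
    (Sigma : 'M[R]_m) (Theta : 'M[R]_n) (X : {RV P >-> 'M[R]_(n, m)}) :=
  exists (c : R) (h : 'M[R]_m -> R),
    has_density X (@lebesgue_mx R n m) (fun x =>
      (c / ((\det Sigma) `^ (n%:R / 2) * (\det Theta) `^ (m%:R / 2)) *
       h (invmx (sqrtmx Sigma) *m (x - mu)^T *m invmx Theta *m (x - mu) *m
          invmx (sqrtmx Sigma)))%:C).

End random_variables.

Section densities.
Local Open Scope complex_scope.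
Context {R : realType}.

(* Density of the inverted hypergeometric gamma type distribution, extended by
   0 outside of the positive half-line. *)
Definition inv_hyp_gamma_pdf (A B : seq R[i]) (a : R[i]) (upsilon xi : R)
    (s : R) : R[i] :=
  if 0 < s then
    cpow xi a / (cGamma a * pFq (rcons A a) B (upsilon / xi)%:C) *
    (expR (- (xi / s)))%:C * cpow s (- a - 1) * pFq A B (upsilon / s)%:C
  else 0.

Definition quad_tr n m (mu : 'M[R]_(n, m)) (Sigma : 'M[R]_m) (Theta : 'M[R]_n)
    (x : 'M[R]_(n, m)) : R :=
  \tr (invmx Sigma *m (x - mu)^T *m invmx Theta *m (x - mu)).

End densities.

(* Main.v *)
Require Import Defs.
From HB Require Import structures.
From mathcomp Require Import all_boot all_order all_algebra complex.
From mathcomp Require Import all_classical all_reals all_analysis.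
From mathcomp Require Import measurable_realfun ring.

Import Order.TTheory GRing.Theory Num.Theory.
Import numFieldNormedType.Exports.

Set Implicit Arguments.
Unset Strict Implicit.
Unset Printing Implicit Defensive.

Local Open Scope classical_set_scope.
Local Open Scope ring_scope.
Local Open Scope complex_scope.

(** The unconditional law of X is a scale mixture: conditioning on S = s and
    integrating s out (Tonelli) shows that X has density
      x |-> int_0^oo f(s, x) g(s) ds,
    where g is the density of S and, for s > 0, f(s, x) is a constant times
    s^(-mn/2) exp(- t(x) / (2 s)).  Multiplying by g only shifts the parameters
    of g: up to constants the integrand is
      s^(-b-1) exp(- c / s) pFq(upsilon / s), b = a + mn/2, c = xi + t(x)/2.
    Expanding pFq into its power series, each term is an inverse gamma integral
    equal to Gamma(b + k) / c^(b + k), and Gamma(b + k) = (b)_k Gamma(b); the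
    factors (b)_k turn pFq into p+1Fq.  This is [has_cintegral_termwise],
    specialized in [has_cintegral_mixture].

    The interchange of sum and integral needs absolute convergence of the
    p+1Fq series at upsilon / c.  If c > xi, this follows from mere convergence
    at upsilon / xi: the terms are bounded there, hence geometrically small at
    upsilon / c.  For x = mu one has c = xi, where convergence may be
    conditional.  Since {mu} is a Lebesgue null set, no integral identity is
    needed there, but a density must still take a nonnegative real value at mu:
    [mixture_ge0_boundary] obtains it as a limit of nonnegative values, by
    Abel's limit theorem [abel_limit].

    All parameters are complex, so the integrals are complex-valued.  A complex
    integral, limit or series is handled by requiring the corresponding real
    statement for Re (w * _) with every complex w ([has_cintegral],
    [has_csum]): w = 1 and w = - i give the real and imaginary parts, and
    complex linearity becomes immediate.

    The density depends on x through t(x) only, and t(x) is the trace of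
    Sigma^(-1/2) (x - mu)' Theta^-1 (x - mu) Sigma^(-1/2), which gives the
    elliptical form.  This uses that a positive definite real matrix has a
    positive definite square root ([posdefmx_sqrt]), a consequence of the
    spectral theorem for normal complex matrices. *)

(** * Positive definite matrices *)

Lemma poly_interpolation (F : fieldType) (f : F -> F) (s : seq F) :
  exists p : {poly F}, {in s, forall x, p.[x] = f x}.
Proof.
elim: s => [|x s [p ps]]; first by exists 0.
have [xs|xs] := boolP (x \in s).
  by exists p => y; rewrite inE => /predU1P[->|]; apply: ps.
pose r := \prod_(y <- s) ('X - y%:P).
have rx : r.[x] != 0 by rewrite -[_ == 0]/(root r x) root_prod_XsubC.
exists (p + ((f x - p.[x]) / r.[x]) *: r) => y.
rewrite inE => /predU1P[->|ys]; rewrite hornerD hornerZ.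
  by rewrite divfK// addrC subrK.
suff -> : r.[y] = 0 by rewrite mulr0 addr0 ps.
by apply/eqP; rewrite -[_ == 0]/(root r y) root_prod_XsubC.
Qed.

Lemma invmx_mul (K : comUnitRingType) k (A B : 'M[K]_k) :
  A \in unitmx -> B \in unitmx -> invmx (A *m B) = invmx B *m invmx A.
Proof.
move=> Au Bu; have ABu : A *m B \in unitmx by rewrite unitmx_mul Au.
by rewrite -[RHS](mulKmx ABu) !mulmxA mulmxK// mulmxK ?mul1mx.
Qed.

Section posdef.
Context {R : realType}.

Lemma dotmx_gt0 k (v : 'rV[R]_k) : v != 0 -> 0 < (v *m v^T) 0 0.
Proof.
move=> /rV0Pn[i vi].
rewrite mxE (bigD1 i)//= mxE ltr_pwDl//.
  by rewrite -expr2 exprn_even_gt0.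
by apply: sumr_ge0 => j _; rewrite mxE -expr2 sqr_ge0.
Qed.

Lemma posdefmx_eigenvalue_gt0 k (A : 'M[R]_k) (r : R) :
  posdefmx A -> eigenvalue A r -> 0 < r.
Proof.
move=> [_ Apos] /eigenvalueP[v vA v0].
by have := Apos v v0; rewrite vA -scalemxAl mxE pmulr_lgt0// dotmx_gt0.
Qed.

Lemma posdefmx_unit k (A : 'M[R]_k) : posdefmx A -> A \in unitmx.
Proof.
move=> [_ Apos]; rewrite -row_free_unit -kermx_eq0; apply/rowV0P => v.
move/sub_kermxP => vA; apply/eqP; apply: contraTT isT => v0.
by have := Apos v v0; rewrite vA mul0mx mxE ltxx.
Qed.

Lemma symmetric_sqr_posdefmx k (A : 'M[R]_k) :
  A^T = A -> A \in unitmx -> posdefmx (A *m A).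
Proof.
move=> At Au; split=> [|v v0]; first by rewrite trmx_mul At.
have -> : v *m (A *m A) *m v^T = (v *m A) *m (v *m A)^T.
  by rewrite trmx_mul At !mulmxA.
apply: dotmx_gt0; apply: contraNneq v0 => vA.
by rewrite -(mulmxK Au v) vA mul0mx.
Qed.

Let rc := @real_complex_def R (Phant R).

Lemma trmx_horner_mx k (A : 'M[R]_k.+1) (p : {poly R}) :
  A^T = A -> (horner_mx A p)^T = horner_mx A p.
Proof.
move=> At; elim/poly_ind: p => [|p c IH]; first by rewrite rmorph0 trmx0.
rewrite rmorphD rmorphM/= horner_mx_X horner_mx_C.
rewrite raddfD/= tr_scalar_mx; congr (_ + _).
rewrite -[LHS]/((horner_mx A p *m A)^T) trmx_mul IH At.
by apply/esym/comm_horner_mx.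
Qed.

(** Over the complex numbers A is diagonalizable, with positive real
    eigenvalues.  A real polynomial mapping each of them to its fourth root,
    evaluated at A, is then a real fourth root of A; like every polynomial in
    A, it is symmetric. *)
Lemma posdefmx_fourth_root k (A : 'M[R]_k.+1) : posdefmx A ->
  exists p : {poly R}, (horner_mx A p) ^+ 4 = A.
Proof.
move=> Apos; have [At _] := Apos.
pose Ac := map_mx rc A.
have Ar : Ac \is a mxOver Num.real.
  by apply/mxOverP => i j; rewrite mxE complex_real.
have As : Ac \is symmetricmx.
  by apply/is_hermitianmxP; rewrite expr0 scale1r map_mx_id// /Ac map_trmx At.
have /orthomx_spectralP := symmetric_normalmx As Ar.
set P := spectralmx Ac; set sp := spectral_diag Ac => AcE.
have Pu : P \in unitmx := spectral_unit Ac.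
pose l i := complex.Re (sp 0 i).
have spE i : sp 0 i = rc (l i).
  have spr : sp \is a mxOver Num.real.
    exact/hermitian_spectral_diag_real/realsym_hermsym.
  by rewrite /rc /l RRe_real//; apply: (mxOverP spr).
have l_gt0 i : 0 < l i.
  apply: (posdefmx_eigenvalue_gt0 Apos).
  rewrite eigenvalue_root_char -(fmorph_root rc) map_char_poly.
  rewrite -[X in root _ X]/(rc (l i)) -spE.
  rewrite -eigenvalue_root_char; apply/eigenvalueP; exists (row i P).
    rewrite -[map_mx _ _]/Ac [in LHS]AcE !mulmxA -row_mul mulmxV// row1 -rowE.
    by rewrite row_diag_mx -scalemxAl -rowE.
  (* the i-th row of the invertible matrix P is an eigenvector *)
  have : row_free P by rewrite row_free_unit.
  by move=> /row_freeP[Q PQ]; apply/eqP => Pi0;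
    move/(congr1 (row i)): PQ; rewrite row_mul Pi0 mul0mx row1 => /rowP/(_ i);
    rewrite !mxE !eqxx => /esym/eqP; rewrite oner_eq0.
have [p pE] := poly_interpolation (fun x => Num.sqrt (Num.sqrt x))
  [seq l i | i <- enum 'I_k.+1].
exists p; apply: (map_mx_inj (f := rc)).
rewrite rmorphXn/= map_horner_mx -[map_mx rc A]/Ac -rmorphXn/=.
rewrite [in LHS]AcE.
have -> : horner_mx (invmx P *m diag_mx sp *m P) (map_poly rc p ^+ 4) =
    invmx P *m horner_mx (diag_mx sp) (map_poly rc p ^+ 4) *m P.
  have := @horner_mx_uconj _ _ (map_poly rc p ^+ 4) (invmx P) (diag_mx sp).
  by rewrite invmxK; apply; rewrite unitmx_inv.
rewrite horner_mx_diag [in RHS]AcE; congr (_ *m diag_mx _ *m _).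
apply/rowP => i; rewrite mxE horner_exp spE horner_map -rmorphXn/=; congr rc.
rewrite pE ?map_f ?mem_enum// (exprM _ 2 2) sqr_sqrtr ?sqrtr_ge0//.
by rewrite sqr_sqrtr ?ltW.
Qed.

(** Taking a fourth root C rather than a square root makes positivity free:
    the square of the invertible symmetric matrix C is positive definite. *)
Lemma posdefmx_sqrt k (A : 'M[R]_k) : posdefmx A ->
  exists B : 'M[R]_k, posdefmx B /\ B *m B = A.
Proof.
case: k A => [|k] A Apos; first by exists A; split=> //; apply/matrixP => -[].
have [p pA] := posdefmx_fourth_root Apos.
pose C := horner_mx A p; exists (C *m C).
have C4 : C *m C *m (C *m C) = A by rewrite -pA (exprM _ 2 2).
split=> //; apply: symmetric_sqr_posdefmx.
  by rewrite trmx_horner_mx; case: Apos.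
have := posdefmx_unit Apos.
by rewrite -C4 !unitmx_mul => /andP[/andP[]].
Qed.

Lemma sqrtmxP k (A : 'M[R]_k) : posdefmx A ->
  posdefmx (sqrtmx A) /\ sqrtmx A *m sqrtmx A = A.
Proof.
move=> /posdefmx_sqrt[B BA].
by apply: (@xgetPex _ 0 [set C | posdefmx C /\ C *m C = A]); exists B.
Qed.

Lemma posdefmx_invmx_sqrt k (A : 'M[R]_k) : posdefmx A ->
  exists B : 'M[R]_k, [/\ B^T = B, B \in unitmx & invmx A = B *m B].
Proof.
move=> /sqrtmxP[Bpos BA]; have Bu := posdefmx_unit Bpos.
exists (invmx (sqrtmx A)); split; rewrite ?unitmx_inv//.
  by rewrite trmx_inv; case: Bpos => ->.
by rewrite -[in LHS]BA invmx_mul.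
Qed.

Lemma posdefmx_det_ge0 k (A : 'M[R]_k) : posdefmx A -> 0 <= \det A.
Proof. by move=> /sqrtmxP[_ <-]; rewrite det_mulmx -expr2 sqr_ge0. Qed.

Lemma posdefmx_det_gt0 k (A : 'M[R]_k) : posdefmx A -> 0 < \det A.
Proof.
move=> Apos; rewrite lt_neqAle posdefmx_det_ge0// andbT eq_sym.
by have := posdefmx_unit Apos; rewrite unitmxE unitfE.
Qed.

(** The trace is the sum of the squares of the entries of Z. *)
Lemma mxtrace_gram_eq0 n m (Z : 'M[R]_(n, m)) :
  0 <= \tr (Z^T *m Z) /\ (\tr (Z^T *m Z) = 0 -> Z = 0).
Proof.
have -> : \tr (Z^T *m Z) = \sum_j \sum_i Z i j ^+ 2.
  by apply: eq_bigr => j _; rewrite mxE; apply: eq_bigr => i _; rewrite mxE.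
have ge0 j : 0 <= \sum_i Z i j ^+ 2 by apply: sumr_ge0 => i _; exact: sqr_ge0.
split=> [|/eqP]; first exact: sumr_ge0.
rewrite psumr_eq0// => /allP Z0; apply/matrixP => i j; rewrite mxE.
have := Z0 j (mem_index_enum j).
rewrite psumr_eq0 => [/allP/(_ i (mem_index_enum i))/=|k _]; last exact: sqr_ge0.
by rewrite sqrf_eq0 => /eqP.
Qed.

Section quad_tr.
Variables (n m : nat) (mu : 'M[R]_(n, m)) (Sigma : 'M[R]_m) (Theta : 'M[R]_n).
Hypotheses (hSigma : posdefmx Sigma) (hTheta : posdefmx Theta).

(** With S and T symmetric square roots of Sigma^-1 and Theta^-1, quad_tr is
    the squared Frobenius norm of T (x - mu) S. *)
Let quad_trE : exists S : 'M[R]_m, exists T : 'M[R]_n, [/\ S \in unitmx, T \in unitmx &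
  forall x, quad_tr mu Sigma Theta x =
    \tr ((T *m (x - mu) *m S)^T *m (T *m (x - mu) *m S))].
Proof.
have [S [St Su SE]] := posdefmx_invmx_sqrt hSigma.
have [T [Tt Tu TE]] := posdefmx_invmx_sqrt hTheta.
exists S, T; split=> // x; rewrite /quad_tr SE TE.
by rewrite !trmx_mul St Tt -!mulmxA mxtrace_mulC -!mulmxA.
Qed.

Lemma quad_tr_ge0 x : 0 <= quad_tr mu Sigma Theta x.
Proof.
by have [S [T [_ _ ->]]] := quad_trE; have [] := mxtrace_gram_eq0 (T *m (x - mu) *m S).
Qed.

Lemma quad_tr_eq0 x : quad_tr mu Sigma Theta x = 0 -> x = mu.
Proof.
have [S [T [Su Tu ->]]] := quad_trE.
have [_ /[apply] Z0] := mxtrace_gram_eq0 (T *m (x - mu) *m S).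
apply/eqP; rewrite -subr_eq0; apply/eqP.
by rewrite -(mulKmx Tu (x - mu)) -(mulmxK Su (T *m _)) Z0 mul0mx mulmx0.
Qed.

Lemma quad_tr_sqrtmx x :
  \tr (invmx (sqrtmx Sigma) *m (x - mu)^T *m invmx Theta *m (x - mu) *m
    invmx (sqrtmx Sigma)) = quad_tr mu Sigma Theta x.
Proof.
have [Bpos BA] := sqrtmxP hSigma; have Bu := posdefmx_unit Bpos.
by rewrite /quad_tr mxtrace_mulC !mulmxA -invmx_mul// BA.
Qed.

End quad_tr.
End posdef.

(** * The space of matrices and the normal density *)

Section matrix_space.
Context {R : realType}.

Definition measurable_mx d (T : measurableType d) n m (f : T -> 'M[R]_(n, m)) :=
  forall i j, measurable_fun setT (fun x => f x i j).

Lemma measurable_mx_mul d (T : measurableType d) n m p (f : T -> 'M[R]_(n, m))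
    (g : T -> 'M[R]_(m, p)) :
  measurable_mx f -> measurable_mx g -> measurable_mx (fun x => f x *m g x).
Proof.
move=> mf mg i k; under eq_fun do rewrite mxE.
by apply: measurable_sum => j; exact: measurable_funM.
Qed.

Lemma measurable_mx_cst d (T : measurableType d) n m (A : 'M[R]_(n, m)) :
  measurable_mx (fun _ : T => A).
Proof. by move=> i j; exact: measurable_cst. Qed.

Lemma measurable_mx_id n m : measurable_mx (@id 'M[R]_(n, m)).
Proof.
move=> i j.
rewrite (_ : (fun x => _) =
    (@tnth _ (measurableTypeR R) ^~ (mxvec_index i j)) \o @tuple_of_mx R n m).
  by apply: measurableT_comp; [exact: measurable_tnth|exact: measurable_tuple_of_mx].
by apply/funext => x /=; rewrite tnth_mktuple mxvecE.
Qed.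

Lemma measurable_quad_tr n m (mu : 'M[R]_(n, m)) (Sigma : 'M[R]_m)
  (Theta : 'M[R]_n) : measurable_fun setT (quad_tr mu Sigma Theta).
Proof.
have mB : measurable_mx (fun x : 'M[R]_(n, m) => x - mu).
  move=> i j; under eq_fun do rewrite !mxE.
  by apply: measurable_funB => //; exact: measurable_mx_id.
have mT : measurable_mx (fun x : 'M[R]_(n, m) => (x - mu)^T).
  by move=> i j; under eq_fun do rewrite mxE; exact: mB.
rewrite /quad_tr /mxtrace; apply: measurable_sum => i.
by do ![apply: measurable_mx_mul => //]; exact: measurable_mx_cst.
Qed.

Lemma lebesgue_mx_set1 n m (mu : 'M[R]_(n, m)) : (0 < n)%N -> (0 < m)%N ->
  lebesgue_mx [set mu] = 0%E.
Proof.
move=> n0 m0; pose i0 := Ordinal n0; pose j0 := Ordinal m0.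
rewrite (_ : [set mu] = [set M | forall i j, [set mu i j] (M i j)]).
  rewrite (lebesgue_mx_box (A := fun i j => [set mu i j]))//.
  rewrite (bigD1 i0)//= (bigD1 j0)//=.
  by rewrite lebesgue_measure_set1 !mul0e.
apply/seteqP; split=> [x -> //|x /= xmu].
by apply/matrixP => i j; exact: xmu.
Qed.

Lemma measurable_set1_mx n m (mu : 'M[R]_(n, m)) : measurable [set mu].
Proof.
rewrite (_ : [set mu] = \bigcap_i \bigcap_j
    ((fun x : 'M[R]_(n, m) => x i j) @^-1` [set mu i j])).
  apply: fin_bigcap_measurable => // i _; apply: fin_bigcap_measurable => // j _.
  by rewrite -[X in measurable X]setTI; exact: measurable_mx_id.
apply/seteqP; split=> [x -> //|x /= xmu].
by apply/matrixP => i j; exact: xmu.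
Qed.

(** Separates the dependence on the scale s of the covariance, which is all
    that matters when s is integrated out. *)
Lemma matrix_normal_pdf_scale n m (mu : 'M[R]_(n, m)) (Sigma : 'M[R]_m)
    (Theta : 'M[R]_n) (s : R) (x : 'M[R]_(n, m)) :
  0 < s -> posdefmx Sigma ->
  matrix_normal_pdf mu (s *: Sigma) Theta x =
  ((2 * pi) `^ ((m * n)%:R / 2) * (\det Sigma) `^ (n%:R / 2) *
   (\det Theta) `^ (m%:R / 2))^-1 *
  (s `^ (- ((m * n)%:R / 2)) * expR (- (2^-1 * quad_tr mu Sigma Theta x / s))).
Proof.
move=> s0 Spos; rewrite /matrix_normal_pdf /etr detZ.
rewrite (powRM _ (exprn_ge0 m (ltW s0)) (posdefmx_det_ge0 Spos)).
rewrite -powR_mulrn ?ltW// -powRrM [m%:R * _]mulrA -natrM.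
rewrite [RHS]mulrA; congr (_ * expR _).
  by rewrite powRN -!invfM; congr (_^-1); ring.
have sSu : s *: Sigma \in unitmx.
  by rewrite unitmxZ ?unitfE ?gt_eqF// posdefmx_unit.
rewrite invmxZ// mxtraceZ -!scalemxAl mxtraceZ /quad_tr.
by rewrite !mulNr; congr (- _); rewrite mulrA mulrAC.
Qed.

End matrix_space.

(** * Complex modulus and complex powers *)

Section complex_modulus.
Context {R : realType}.
Implicit Types (z w : R[i]) (x y r : R).

(** The norm of R[i] takes values in R[i]; integrals and bounds need it in R. *)
Definition cmod z : R := complex.Re `|z|.

Lemma cmodE z : `|z| = (cmod z)%:C.
Proof. by rewrite /cmod normc_def. Qed.

Lemma cmod_ge0 z : 0 <= cmod z.
Proof. by rewrite -lecR -cmodE; exact: normr_ge0. Qed.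

Lemma cmodM z w : cmod (z * w) = cmod z * cmod w.
Proof. by apply: complexI; rewrite -cmodE normrM !cmodE -rmorphM. Qed.

Lemma cmodC x : cmod x%:C = `|x|.
Proof. by rewrite /cmod normc_def/= expr0n addr0 sqrtr_sqr. Qed.

Lemma cmodD z w : cmod (z + w) <= cmod z + cmod w.
Proof. by rewrite -lecR rmorphD/= -!cmodE ler_normD. Qed.

Lemma cmod_sum (I : Type) (s : seq I) (f : I -> R[i]) :
  cmod (\sum_(i <- s) f i) <= \sum_(i <- s) cmod (f i).
Proof.
elim/big_rec2 : _ => [|i y z _ yz]; first by rewrite cmodC normr0.
by rewrite (le_trans (cmodD _ _))// lerD2l.
Qed.

Lemma Re_le_cmod z : `|complex.Re z| <= cmod z.
Proof. by rewrite -lecR -cmodE normc_ge_Re. Qed.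

Lemma ReM z w :
  complex.Re (z * w) = complex.Re z * complex.Re w - complex.Im z * complex.Im w.
Proof. by case: z w => [a b] [c d]. Qed.

Lemma ImM z w :
  complex.Im (z * w) = complex.Re z * complex.Im w + complex.Im z * complex.Re w.
Proof. by case: z w => [a b] [c d]. Qed.

Lemma ReMC z x : complex.Re (z * x%:C) = complex.Re z * x.
Proof. by rewrite ReM mulr0 subr0. Qed.

Lemma ReD z w : complex.Re (z + w) = complex.Re z + complex.Re w.
Proof. by case: z w => [a b] [c d]. Qed.

Lemma ReB1 z : complex.Re (z - 1) = complex.Re z - 1.
Proof. by case: z. Qed.

Lemma ImB1 z : complex.Im (z - 1) = complex.Im z.
Proof. by case: z => a b /=; rewrite subr0. Qed.

Lemma Re_sum (I : Type) (s : seq I) (f : I -> R[i]) :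
  complex.Re (\sum_(i <- s) f i) = \sum_(i <- s) complex.Re (f i).
Proof. by elim/big_rec2 : _ => [//|i y z _ <-]; rewrite ReD. Qed.

(** Together with Re (1 * z) = Re z, this is why statements about Re (w * z)
    for all w determine z. *)
Lemma ImE z : complex.Im z = complex.Re (- 'i * z).
Proof. by case: z => [a b]; rewrite ReM/=; ring. Qed.

Lemma eq_Re z w : (forall u, complex.Re (u * z) = complex.Re (u * w)) -> z = w.
Proof.
move=> zw; apply/eqP; rewrite eq_complex; apply/andP.
by split; apply/eqP; [have := zw 1; rewrite !mul1r|rewrite !ImE].
Qed.

Lemma complex_ge0P z : reflect (complex.Im z = 0 /\ 0 <= complex.Re z) (0 <= z).
Proof. by rewrite lecE/=; apply: (iffP andP) => [[/eqP->]|[->]]; rewrite ?eqxx. Qed.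

Lemma cvg_Re (u : nat -> R[i]) (l w : R[i]) :
  (u : nat -> R[i]^o) @ \oo --> (l : R[i]^o) ->
  complex.Re (w * u n) @[n --> \oo] --> complex.Re (w * l).
Proof.
move=> ul.
have {}ul : (fun n => w * u n : R[i]^o) @ \oo --> (w * l : R[i]^o).
  by apply: cvgM => //; exact: cvg_cst.
apply/cvgrPdist_le => e e0; move/cvgrPdist_le : ul => /(_ e%:C).
rewrite ltcR => /(_ e0); apply: filterS => n.
rewrite cmodE lecR; apply: le_trans.
by rewrite -mulrBr -raddfB/= -mulrBr Re_le_cmod.
Qed.

End complex_modulus.

Section complex_power.
Context {R : realType}.
Implicit Types (z w : R[i]) (x y r : R).

Lemma expCD z w : expC (z + w) = expC z * expC w.
Proof.
case: z w => [a b] [c d]; rewrite /expC/= expRD cosD sinD rmorphM/=.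
by apply/eqP; rewrite eq_complex/=; apply/andP; split; apply/eqP; ring.
Qed.

Lemma expC0 : expC (0 : R[i]) = 1.
Proof. by rewrite /expC/= expR0 cos0 sin0 mul1r. Qed.

Lemma cmod_expC z : cmod (expC z) = expR (complex.Re z).
Proof.
rewrite /expC cmodM cmodC ger0_norm ?expR_ge0//.
by rewrite /cmod normc_def/= cos2Dsin2 sqrtr1 mulr1.
Qed.

Lemma cpowD x z w : cpow x (z + w) = cpow x z * cpow x w.
Proof. by rewrite /cpow mulrDl expCD. Qed.

Lemma cpow0 x : cpow x 0 = 1.
Proof. by rewrite /cpow mul0r expC0. Qed.

Lemma cpowNM x z : cpow x z * cpow x (- z) = 1.
Proof. by rewrite -cpowD subrr cpow0. Qed.

Lemma cpow_neq0 x z : cpow x z != 0.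
Proof.
by apply: contra_eqN (cpowNM x z) => /eqP ->; rewrite mul0r eq_sym oner_eq0.
Qed.

Lemma cpowN x z : cpow x (- z) = (cpow x z)^-1.
Proof. by apply: (mulfI (cpow_neq0 x z)); rewrite cpowNM divff// cpow_neq0. Qed.

Lemma cmod_cpow x z : 0 < x -> cmod (cpow x z) = x `^ complex.Re z.
Proof. by move=> x0; rewrite /cpow cmod_expC ReMC /powR gt_eqF. Qed.

Lemma cpow_real x r : 0 < x -> cpow x r%:C = (x `^ r)%:C.
Proof.
move=> x0; rewrite /cpow /expC /= !(mulr0, mul0r, subr0, addr0) cos0 sin0 mulr1.
by rewrite /powR gt_eqF.
Qed.

Lemma cpow_nat x k : 0 < x -> cpow x k%:R = (x ^+ k)%:C.
Proof.
move=> x0; have -> : k%:R = (k%:R : R)%:C by rewrite rmorph_nat.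
by rewrite cpow_real// powR_mulrn// ltW.
Qed.

Lemma cpowM x y z : 0 < x -> 0 < y -> cpow (x * y) z = cpow x z * cpow y z.
Proof. by move=> x0 y0; rewrite /cpow lnM// rmorphD/= mulrDr expCD. Qed.

Lemma cpowV x z : 0 < x -> cpow x^-1 z = cpow x (- z).
Proof. by move=> x0; rewrite /cpow lnV// rmorphN mulrN mulNr. Qed.

Lemma Re_cpow w x z : 0 < x -> complex.Re (w * cpow x z) =
  x `^ complex.Re z * (complex.Re w * cos (complex.Im z * ln x)
    - complex.Im w * sin (complex.Im z * ln x)).
Proof.
move=> x0; rewrite /cpow /expC !ReM ImM /= !(mulr0, mul0r, subr0, addr0, add0r).
by rewrite /powR gt_eqF//; ring.
Qed.

(** For all w at once: the derivative of x^z is z x^(z-1). *)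
Lemma is_derive_Re_cpow w x z : 0 < x ->
  is_derive x 1 (fun y => complex.Re (w * cpow y z))
    (complex.Re (w * (z * cpow x (z - 1)))).
Proof.
move=> x0.
set r := complex.Re z; set t := complex.Im z.
pose c y := cos (t * ln y); pose s y := sin (t * ln y).
pose A := complex.Re w; pose B := complex.Im w.
apply: (@near_eq_is_derive _ _ _
    ((@powR R)^~ r * (A \*: c - B \*: s))) => //.
  near=> y; rewrite Re_cpow ?/= //.
  near: y; exact: lt_nbhsr.
have dl : is_derive x 1 (fun y => t * ln y) (t * x^-1).
  by have := is_derive1_ln x0 => d; apply: is_deriveZ.
have dc : is_derive x 1 c (- sin (t * ln x) * (t * x^-1)).
  exact: (is_derive1_comp (is_derive_cos _) dl).
have ds : is_derive x 1 s (cos (t * ln x) * (t * x^-1)).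
  exact: (is_derive1_comp (is_derive_sin _) dl).
have dp := is_derive1_powR r x0.
apply: is_derive_eq.
rewrite [w * _]mulrA Re_cpow// ReM ImM /= ReB1 ImB1 -/r -/t -/A -/B.
have -> : x `^ r = x `^ (r - 1) * x.
  rewrite -[X in _ * X](powRr1 (ltW x0)) -powRD ?subrK//.
  by apply/implyP => _; rewrite gt_eqF.
rewrite (_ : (A \*: c - B \*: s) x = A * c x - B * s x)// /GRing.scale/= /c /s.
by field; rewrite gt_eqF.
Unshelve. all: by end_near. Qed.

Lemma continuous_Re_cpow w x z : 0 < x ->
  {for x, continuous (fun y => complex.Re (w * cpow y z))}.
Proof.
move=> x0; apply: differentiable_continuous; apply/derivable1_diffP.
by have [] := is_derive_Re_cpow w z x0.
Qed.

End complex_power.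

(** * Real integrals over the positive half-line *)

Section half_line.
Context {R : realType}.
Local Notation mu := (@lebesgue_measure R).
Implicit Types (f g F : R -> R) (c x : R).

(** These compact intervals exhaust the half-line; the substitution x |-> c / x
    maps [itv 1 n] onto [itv c n]. *)
Let itv c n : set R := `[c * n.+1%:R^-1, c * n.+1%:R].

Let itv_gt0 c n x : 0 < c -> itv c n x -> 0 < x.
Proof.
move=> c0; rewrite /itv/= in_itv/= => /andP[+ _]; apply: lt_le_trans.
by rewrite mulr_gt0// invr_gt0.
Qed.

Let itv_mono c : 0 < c -> {homo itv c : n m / (n <= m)%N >-> (n <= m)%O}.
Proof.
move=> c0 n m nm; rewrite /itv subsetEset; apply: subset_itv; rewrite bnd_simp ler_pM2l//.
  by rewrite lef_pV2 ?posrE// ler_nat ltnS.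
by rewrite ler_nat ltnS.
Qed.

Let itv_bigcup c : 0 < c -> \bigcup_n (itv c n) = `]0, +oo[%classic.
Proof.
move=> c0; apply/seteqP; split=> [x [n _ /(itv_gt0 c0) x0]|x]; rewrite /= in_itv/= andbT //.
move=> x0.
pose n1 := Num.truncn (x / c); pose n2 := Num.truncn (c / x).
exists (maxn n1 n2) => //; rewrite /itv/= in_itv/=; apply/andP; split.
  have : c / x <= (maxn n1 n2).+1%:R.
    by rewrite (le_trans (ltW (truncnS_gt _)))// ler_nat ltnS leq_maxr.
  by rewrite ler_pdivrMr// ler_pdivrMr// mulrC.
have : x / c <= (maxn n1 n2).+1%:R.
  by rewrite (le_trans (ltW (truncnS_gt _)))// ler_nat ltnS leq_maxl.
by rewrite ler_pdivrMr// mulrC.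
Qed.

Lemma measurable_fun_gt0 f : (forall x, 0 < x -> {for x, continuous f}) ->
  measurable_fun (`]0, +oo[%classic : set R) f.
Proof.
move=> cf; apply: open_continuous_measurable_fun => // x.
by rewrite inE/= in_itv/= andbT => /cf.
Qed.

Let cvg_ge0 c f : 0 < c -> measurable_fun (`]0, +oo[%classic : set R) f ->
  (forall x, 0 < x -> 0 <= f x) ->
  (\int[mu]_(x in itv c n) (f x)%:E)%E @[n --> \oo] -->
  (\int[mu]_(x in `]0%R, +oo[) (f x)%:E)%E.
Proof.
move=> c0 mf f0; rewrite -(itv_bigcup c0).
apply: ge0_nondecreasing_set_cvg_integral.
- exact: itv_mono.
- by move=> n; exact: measurable_itv.
- move=> n; apply/measurable_EFinP.
  apply: measurable_funS mf => //.
  by move=> x /(itv_gt0 c0); rewrite /= in_itv/= andbT.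
- by move=> n x /(itv_gt0 c0) /f0; rewrite lee_fin.
Qed.

Let FTC a b f F : 0 < a -> a < b ->
  (forall x, 0 < x -> {for x, continuous f}) ->
  (forall x : R, 0 < x -> is_derive x 1 F (f x)) ->
  (\int[mu]_(x in `[a, b]) (f x)%:E = (F b)%:E - (F a)%:E)%E.
Proof.
move=> a0 ab cf dF.
have cF x : 0 < x -> {for x, continuous F}.
  move=> x0; apply: differentiable_continuous; apply/derivable1_diffP.
  by have [] := dF x x0.
apply: continuous_FTC2 => //.
- apply: continuous_in_subspaceT => x; rewrite inE/= in_itv/= => /andP[ax _].
  by apply: cf; exact: lt_le_trans ax.
- split=> [x||].
  + by rewrite in_itv/= => /andP[ax _]; have [] := dF x (lt_trans a0 ax).
  + by apply: cvg_at_right_filter; exact: cF.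
  + by apply: cvg_at_left_filter; apply: cF; exact: lt_trans ab.
- move=> x; rewrite in_itv/= => /andP[ax _].
  by rewrite derive1E; have [] := dF x (lt_trans a0 ax).
Qed.

Let itv1_lt n : (0 < n)%N -> 1 * n.+1%:R^-1 < 1 * n.+1%:R :> R.
Proof.
move=> n0; rewrite !mul1r (lt_trans (_ : _ < 1))// ?ltr1n//.
by rewrite invf_lt1// ltr1n.
Qed.

(** A nonnegative function with a bounded primitive: by the fundamental theorem
    its integrals over the exhausting intervals stay bounded. *)
Lemma integrable_derive_gt0 f F (C : R) :
  (forall x, 0 < x -> {for x, continuous f}) ->
  (forall x, 0 < x -> 0 <= f x) ->
  (forall x : R, 0 < x -> is_derive x 1 F (f x)) ->
  (forall x, 0 < x -> 0 <= F x <= C) ->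
  mu.-integrable `]0, +oo[ (EFin \o f).
Proof.
move=> cf f0 dF FC; have mf := measurable_fun_gt0 cf.
apply/integrableP; split; first exact/measurable_EFinP.
under eq_integral => x xD.
  rewrite gee0_abs; last first.
    by rewrite lee_fin f0//; move: xD; rewrite inE/= in_itv/= andbT.
  over.
apply: (@le_lt_trans _ _ C%:E); last by rewrite ltry.
apply: cvge_le (cvg_ge0 ltr01 mf f0).
exists 1%N => // n /= n0.
rewrite (FTC _ (itv1_lt n0) cf dF) ?mul1r ?invr_gt0//.
rewrite -EFinB lee_fin.
have /andP[_ FnC] := FC n.+1%:R (ltr0Sn _ _).
have /andP[Fn0 _] : 0 <= F n.+1%:R^-1 <= C by apply: FC; rewrite invr_gt0.
by rewrite lerBlDr (le_trans FnC)// lerDl.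
Qed.

Let EFin_funepos f : (EFin \o f)^\+%E = (fun x => (Num.max (f x) 0)%:E).
Proof. by apply/funext => x; rewrite funeposE/= EFin_max. Qed.

Let EFin_funeneg f : (EFin \o f)^\-%E = (fun x => (Num.max (- f x) 0)%:E).
Proof. by apply/funext => x; rewrite funenegE/= EFin_max EFinN. Qed.

Let continuous_pos f x : {for x, continuous f} ->
  {for x, continuous (fun y : R => Num.max (f y) 0)}.
Proof. by move=> cf; apply: continuous_max => //; exact: cvg_cst. Qed.

Let continuous_neg f x : {for x, continuous f} ->
  {for x, continuous (fun y : R => Num.max (- f y) 0)}.
Proof. by move=> cf; apply: continuous_max; [exact: cvgN|exact: cvg_cst]. Qed.

(** The monotone case applied to the positive and negative parts, which are
    again continuous. *)
Let cvg_integrable c f : 0 < c ->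
  (forall x, 0 < x -> {for x, continuous f}) ->
  mu.-integrable `]0, +oo[ (EFin \o f) ->
  (\int[mu]_(x in itv c n) (f x)%:E)%E @[n --> \oo] -->
  (\int[mu]_(x in `]0%R, +oo[) (f x)%:E)%E.
Proof.
move=> c0 cf fi.
under eq_cvg do rewrite integralE EFin_funepos EFin_funeneg.
rewrite integralE EFin_funepos EFin_funeneg.
apply: cvgeB.
- have := (fun m => integrable_add_def m fi) (measurable_itv _).
  by rewrite EFin_funepos EFin_funeneg.
- apply: cvg_ge0 => // [|x _]; last by rewrite le_max lexx orbT.
  by apply: measurable_fun_gt0 => x x0; apply: continuous_pos; exact: cf.
- apply: cvg_ge0 => // [|x _]; last by rewrite le_max lexx orbT.
  by apply: measurable_fun_gt0 => x x0; apply: continuous_neg; exact: cf.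
Qed.

Lemma integral_derive_gt0 f F :
  (forall x, 0 < x -> {for x, continuous f}) ->
  mu.-integrable `]0, +oo[ (EFin \o f) ->
  (forall x : R, 0 < x -> is_derive x 1 F (f x)) ->
  F n.+1%:R^-1 @[n --> \oo] --> 0 ->
  F n.+1%:R @[n --> \oo] --> 0 ->
  (\int[mu]_(x in `]0%R, +oo[) (f x)%:E = 0)%E.
Proof.
move=> cf fi dF F0 Foo.
have H1 := cvg_integrable ltr01 cf fi.
suff H2 : (\int[mu]_(x in itv 1 n) (f x)%:E)%E @[n --> \oo] --> 0%E.
  by rewrite -(cvg_lim _ H1)// (cvg_lim _ H2).
have : (F n.+1%:R - F n.+1%:R^-1)%:E @[n --> \oo] --> 0%E.
  by apply: cvg_EFin; [exact: nearW|rewrite -[X in _ --> X](subr0 0); exact: cvgB].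
apply: cvg_trans; apply: near_eq_cvg; exists 1%N => // n /= n0.
by rewrite (FTC _ (itv1_lt n0) cf dF) ?mul1r ?invr_gt0.
Qed.

Let is_derive_divl c x : 0 < x ->
  is_derive x 1 (fun y : R => c / y) (- (c / x ^+ 2)).
Proof.
move=> x0; have xn0 : x != 0 by rewrite gt_eqF.
have dV : is_derive x 1 (fun y : R => y^-1) (- x ^- 2).
  by have := @is_deriveV R id x 1 1 xn0 (is_derive_id _ _); rewrite /GRing.scale/= mulr1.
by apply: (is_derive_eq (is_deriveZ c dV)); rewrite scalerN.
Qed.

(** Change of variables on each exhausting interval, then passage to the
    limit. *)
Let subst_ge0 c f : 0 < c ->
  (forall x, 0 < x -> {for x, continuous f}) ->
  (forall x, 0 < x -> 0 <= f x) ->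
  (\int[mu]_(x in `]0%R, +oo[) (f x)%:E =
   \int[mu]_(x in `]0%R, +oo[) (f (c / x) * (c / x ^+ 2))%:E)%E.
Proof.
move=> c0 cf f0.
have cg x : 0 < x -> {for x, continuous (fun y : R => c / y)}.
  move=> x0; apply: differentiable_continuous; apply/derivable1_diffP.
  by have [] := is_derive_divl c x0.
have cg' x : 0 < x -> {for x, continuous (fun y : R => c / y ^+ 2)}.
  move=> x0; apply: cvgM; first exact: cvg_cst.
  apply: cvgV; first by rewrite expf_neq0// gt_eqF.
  exact: exprn_continuous.
have cfg x : 0 < x -> {for x, continuous (fun y : R => f (c / y) * (c / y ^+ 2))}.
  move=> x0; apply: cvgM; last exact: cg'.
  apply: (@continuous_comp _ _ _ (fun y : R => c / y) f); first exact: cg.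
  by apply: cf; exact: divr_gt0.
have H1 := cvg_ge0 c0 (measurable_fun_gt0 cf) f0.
have fg0 x : 0 < x -> 0 <= f (c / x) * (c / x ^+ 2).
  move=> x0; rewrite mulr_ge0 ?f0 ?divr_gt0//.
  by rewrite ltW// divr_gt0// exprn_gt0.
have H2 := cvg_ge0 ltr01 (measurable_fun_gt0 cfg) fg0.
apply: (cvg_unique _ H1) => //.
rewrite (_ : (fun n => _) = fun n =>
  (\int[mu]_(x in itv 1 n) (f (c / x) * (c / x ^+ 2))%:E)%E) //.
apply/funext => n.
pose F x := c / x.
have F'E x : 0 < x -> derive1 F x = - (c / x ^+ 2).
  by move=> x0; rewrite derive1E; have [] := is_derive_divl c x0.
have F'c x : 0 < x -> derive1 F y @[y --> x] --> derive1 F x.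
  move=> x0; rewrite F'E//.
  apply: (@cvg_trans _ ((fun y : R => - (c / y ^+ 2)) @ x)).
    by apply: near_eq_cvg; near=> y; rewrite F'E//; near: y; exact: lt_nbhsr.
  exact: (cvgN (cg' _ x0)).
have n0 : 0 < n.+1%:R^-1 :> R by rewrite invr_gt0.
have nle : n.+1%:R^-1 <= n.+1%:R :> R.
  by rewrite (le_trans (_ : _ <= 1))// ?invf_le1// ler1n.
have := @integration_by_substitution_decreasing R F f n.+1%:R^-1 n.+1%:R nle.
have -> : F n.+1%:R^-1 = c * n.+1%:R by rewrite /F invrK.
rewrite /itv !mul1r => ->.
- apply: eq_integral => x; rewrite inE/= in_itv/= => /andP[nx _].
  rewrite -[LHS]/((f (F x) * - derive1 F x)%:E).
  by rewrite F'E ?opprK//; exact: lt_le_trans nx.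
- move=> x y; rewrite !in_itv/= => /andP[nx _] /andP[ny _] xy.
  by rewrite ltr_pM2l// ltf_pV2// posrE (lt_le_trans n0).
- by move=> x; rewrite in_itv/= => /andP[nx _]; apply: F'c; exact: lt_trans nx.
- by apply/cvg_ex; eexists; apply: cvg_at_right_filter; exact: F'c.
- by apply/cvg_ex; eexists; apply: cvg_at_left_filter; exact: F'c.
- split=> [x||].
  + rewrite in_itv/= => /andP[nx _].
    by have [] := is_derive_divl c (lt_trans n0 nx).
  + by apply: cvg_at_right_filter; exact: cg.
  + by apply: cvg_at_left_filter; exact: cg.
- apply: continuous_in_subspaceT => x; rewrite inE/= in_itv/= => /andP[nx _].
  by apply: cf; apply: lt_le_trans nx; rewrite divr_gt0.
Unshelve. all: by end_near. Qed.

(** Integrals are defined through positive and negative parts, and the change of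
    variables acts on each of them; so the equality covers divergent integrals,
    and can be used to prove integrability. *)
Lemma integral_divl_gt0 c f : 0 < c ->
  (forall x, 0 < x -> {for x, continuous f}) ->
  (\int[mu]_(x in `]0%R, +oo[) (f x)%:E =
   \int[mu]_(x in `]0%R, +oo[) (f (c / x) * (c / x ^+ 2))%:E)%E.
Proof.
move=> c0 cf.
rewrite integralE EFin_funepos EFin_funeneg.
rewrite [RHS]integralE EFin_funepos EFin_funeneg.
have max_pM (r x : R) : 0 < x ->
    Num.max (r * (c / x ^+ 2)) 0 = Num.max r 0 * (c / x ^+ 2).
  move=> x0; rewrite -[in LHS](mul0r (c / x ^+ 2)) maxr_pMl// ltW//.
  by rewrite divr_gt0// exprn_gt0.
congr (_ - _)%E; (rewrite (subst_ge0 c0); last 2 first);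
  try (by move=> x _; rewrite le_max lexx orbT);
  try (by move=> x x0; apply: continuous_pos; exact: cf);
  try (by move=> x x0; apply: continuous_neg; exact: cf).
- apply: eq_integral => x; rewrite inE/= in_itv/= andbT => x0.
  by rewrite max_pM.
- apply: eq_integral => x; rewrite inE/= in_itv/= andbT => x0.
  by rewrite -mulNr max_pM.
Qed.

End half_line.

(** * Complex-valued integrals over the positive half-line *)

Section complex_integral.
Context {R : realType}.
Local Notation mu := (@lebesgue_measure R).
Implicit Types (f g : R -> R) (phi : R -> R[i]) (x c : R) (w z I J : R[i]).

Lemma le_integrable_gt0 f g :
  measurable_fun (`]0, +oo[%classic : set R) f ->
  (forall x, 0 < x -> `|f x| <= g x) ->
  mu.-integrable `]0, +oo[ (EFin \o g) -> mu.-integrable `]0, +oo[ (EFin \o f).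
Proof.
move=> mf fg gi; apply: (le_integrable _ _ _ gi) => //.
- exact/measurable_EFinP.
- move=> x; rewrite /= in_itv/= andbT => x0.
  by rewrite lee_fin (le_trans (fg x x0))// ler_norm.
Qed.

(** The complex integral of phi is I.  Quantifying over w covers the real and
    imaginary parts together and makes the notion stable under multiplication by
    complex constants. *)
Definition has_cintegral phi I := forall w,
  mu.-integrable `]0, +oo[ (EFin \o (fun x => complex.Re (w * phi x))) /\
  (\int[mu]_(x in `]0%R, +oo[) (complex.Re (w * phi x))%:E =
   (complex.Re (w * I))%:E)%E.

Lemma has_cintegralZ z phi I :
  has_cintegral phi I -> has_cintegral (fun x => z * phi x) (z * I).
Proof.
move=> phiI w; have := phiI (w * z); rewrite -mulrA.
have e : (fun x : R => complex.Re (w * z * phi x)) =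
    (fun x => complex.Re (w * (z * phi x))) by apply/funext => x; rewrite mulrA.
rewrite e; case=> fi <-; split=> //; apply: eq_integral => x _.
by rewrite mulrA.
Qed.

Lemma has_cintegralD phi psi I J : has_cintegral phi I -> has_cintegral psi J ->
  has_cintegral (fun x => phi x + psi x) (I + J).
Proof.
move=> phiI psiJ w; have [fi fI] := phiI w; have [gi gJ] := psiJ w.
pose f x := complex.Re (w * phi x); pose g x := complex.Re (w * psi x).
have e : (fun x => complex.Re (w * (phi x + psi x))) = (fun x => f x + g x).
  by apply/funext => x; rewrite mulrDr ReD.
rewrite e; split; first by have := (fun m => integrableD m fi gi) (measurable_itv _).
transitivity (\int[mu]_(x in `]0%R, +oo[) ((EFin \o f) x + (EFin \o g) x))%E.
  by apply: eq_integral => x _; rewrite mulrDr ReD EFinD.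
by rewrite integralD// [X in (X + _)%E]fI [X in (_ + X)%E]gJ mulrDr ReD EFinD.
Qed.

Lemma has_cintegral0 : has_cintegral (fun=> 0) 0.
Proof.
move=> w; rewrite mulr0; split; last by rewrite integral0.
rewrite (_ : _ \o _ = cst 0%E); first exact: integrable0.
by apply/funext => x.
Qed.

Lemma has_cintegral_sum n (phi : nat -> R -> R[i]) (I : nat -> R[i]) :
  (forall k, has_cintegral (phi k) (I k)) ->
  has_cintegral (fun x => \sum_(0 <= k < n) phi k x) (\sum_(0 <= k < n) I k).
Proof.
move=> phiI; elim: n => [|n IH].
  by rewrite big_geq//; under eq_fun do rewrite big_geq//; exact: has_cintegral0.
rewrite big_nat_recr//=; under eq_fun do rewrite big_nat_recr//=.
exact: has_cintegralD.
Qed.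

Lemma has_cintegral_dominated phi g :
  (forall w x, 0 < x -> {for x, continuous (fun y => complex.Re (w * phi y))}) ->
  (forall x, 0 < x -> cmod (phi x) <= g x) ->
  mu.-integrable `]0, +oo[ (EFin \o g) ->
  has_cintegral phi
    ((\int[mu]_(x in `]0, +oo[) complex.Re (phi x)) +i*
     (\int[mu]_(x in `]0, +oo[) complex.Im (phi x))).
Proof.
move=> cphi phig gi.
have wi w : mu.-integrable `]0, +oo[ (EFin \o (fun x => complex.Re (w * phi x))).
  apply: (@le_integrable_gt0 _ (fun x => cmod w * g x)).
  - by apply: measurable_fun_gt0; exact: cphi.
  - move=> x x0; rewrite (le_trans (Re_le_cmod _))// cmodM.
    by rewrite ler_wpM2l ?cmod_ge0// phig.
  - by have := (fun m => @integrableZl _ _ _ _ _ m (cmod w) _ gi) (measurable_itv _).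
have ri : mu.-integrable `]0, +oo[ (EFin \o (fun x => complex.Re (phi x))).
  by have := wi 1; congr (mu.-integrable _ _); apply/funext => x /=; rewrite mul1r.
have ii : mu.-integrable `]0, +oo[ (EFin \o (fun x => complex.Im (phi x))).
  by have := wi (- 'i); congr (mu.-integrable _ _); apply/funext => x /=; rewrite -ImE.
move=> w; split=> //.
transitivity (\int[mu]_(x in `]0, +oo[)
    (complex.Re w * complex.Re (phi x) - complex.Im w * complex.Im (phi x)))%:E.
  rewrite /Rintegral fineK.
    by apply: eq_integral => x _; rewrite ReM.
  apply: integrable_fin_num => //.
  by have := wi w; congr (mu.-integrable _ _); apply/funext => x /=; rewrite ReM.
have ri' r : mu.-integrable `]0, +oo[ (EFin \o (fun x => r * complex.Re (phi x))).
  by have := (fun m => @integrableZl _ _ _ _ _ m r _ ri) (measurable_itv _).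
have ii' r : mu.-integrable `]0, +oo[ (EFin \o (fun x => r * complex.Im (phi x))).
  by have := (fun m => @integrableZl _ _ _ _ _ m r _ ii) (measurable_itv _).
by rewrite RintegralB// !RintegralZl// ReM.
Qed.

End complex_integral.

Section dominated.
Context {R : realType}.
Local Notation mu := (@lebesgue_measure R).
Implicit Types (phi : R -> R[i]) (x c : R) (w z I J : R[i]).

(** Dominated convergence; the bound g may be infinite on a null set, as it will
    be the sum of a series of functions. *)
Lemma has_cintegral_lim (phi_ : nat -> R -> R[i]) (I_ : nat -> R[i]) phi I
    (g : R -> \bar R) :
  (forall n, has_cintegral (phi_ n) (I_ n)) ->
  (forall w x, 0 < x ->
    complex.Re (w * phi_ n x) @[n --> \oo] --> complex.Re (w * phi x)) ->
  (forall n x, 0 < x -> ((cmod (phi_ n x))%:E <= g x)%E) ->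
  mu.-integrable `]0, +oo[ g ->
  (forall w, complex.Re (w * I_ n) @[n --> \oo] --> complex.Re (w * I)) ->
  has_cintegral phi I.
Proof.
move=> phiI phiphi phig gi II w.
pose f_ n x := (complex.Re (w * phi_ n x))%:E.
pose f x := (complex.Re (w * phi x))%:E.
have fi n : mu.-integrable `]0, +oo[ (f_ n) by have [] := phiI n w.
have mf_ n : measurable_fun (`]0, +oo[%classic : set R) (f_ n).
  by have /integrableP[] := fi n.
have ff x : `]0, +oo[%classic x -> f_ n x @[n --> \oo] --> f x.
  rewrite /= in_itv/= andbT => x0; apply: cvg_EFin; first exact: nearW.
  exact: phiphi.
have mf : measurable_fun (`]0, +oo[%classic : set R) f.
  exact: emeasurable_fun_cvg mf_ ff.
have [|||wfi _ wfI] := @dominated_convergence _ _ _ mu _ (measurable_itv _) f_ f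
    (fun x => (cmod w)%:E * g x)%E mf_ mf.
- exact: aeW.
- by have := (fun m => @integrableZl _ _ _ _ _ m (cmod w) _ gi) (measurable_itv _).
- apply: aeW => x n; rewrite /= in_itv/= andbT => x0.
  rewrite (@le_trans _ _ ((cmod w)%:E * (cmod (phi_ n x))%:E)%E)//.
    by rewrite -EFinM lee_fin (le_trans (Re_le_cmod _))// cmodM.
  by rewrite lee_wpmul2l ?lee_fin ?cmod_ge0 ?phig.
split=> //; apply: (cvg_unique _ wfI) => //.
have {}II : (complex.Re (w * I_ n))%:E @[n --> \oo] --> (complex.Re (w * I))%:E.
  by apply: cvg_EFin; [exact: nearW|exact: II].
apply: cvg_trans II; apply: near_eq_cvg; apply: nearW => n.
by have [_ e] := phiI n w; rewrite /= -e.
Qed.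

End dominated.

(** * The complex gamma function and the inverse gamma integral *)

Section gamma.
Context {R : realType}.
Local Notation mu := (@lebesgue_measure R).
Implicit Types (x c r : R) (w z : R[i]).

(** From y <= exp y at y = x / (2 r), raised to the power r. *)
Lemma powR_le_expR r x : 0 < r -> 0 < x ->
  x `^ r <= (2 * r) `^ r * expR (x / 2).
Proof.
move=> r0 x0; have r20 : 0 < 2 * r by rewrite mulr_gt0.
have xr0 : 0 < x / (2 * r) by rewrite divr_gt0.
have {1 2}-> : x = (2 * r) * (x / (2 * r)) by rewrite mulrC divfK// gt_eqF.
rewrite (powRM _ (ltW r20) (ltW xr0)) ler_wpM2l ?powR_ge0//.
have -> : 2 * r * (x / (2 * r)) / 2 = x / (2 * r) * r by field; rewrite gt_eqF.
rewrite expRM ge0_ler_powR ?nnegrE ?expR_ge0 ?ltW//.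
by rewrite (lt_le_trans _ (expR_ge1Dx _))// ltrDr.
Qed.

(** Up to a constant the integrand is dominated by the derivative of the bounded
    function x^r / (1 + x^r), both near 0 and at infinity. *)
Lemma integrable_gamma r : 0 < r ->
  mu.-integrable `]0, +oo[ (EFin \o (fun x => x `^ (r - 1) * expR (- x))).
Proof.
move=> r0; pose C := 1 + (2 * r) `^ r.
have C0 : 0 < C by rewrite ltr_pwDl// powR_ge0.
have cpow s x : 0 < x -> {for x, continuous (fun y : R => y `^ s)}.
  move=> x0; apply: differentiable_continuous; apply/derivable1_diffP.
  by have [] := is_derive1_powR s x0.
have p0 x : 0 < 1 + x `^ r by rewrite ltr_pwDl// powR_ge0.
pose F x := 1 - (1 + x `^ r)^-1.
pose f x := (1 + x `^ r) ^- 2 * (r * x `^ (r - 1)).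
have dF x : 0 < x -> is_derive x 1 F (f x).
  move=> x0; have dp := is_derive1_powR r x0.
  have d1 : is_derive x 1 (fun y : R => 1 + y `^ r) (r * x `^ (r - 1)).
    by have := is_deriveD (is_derive_cst (1 : R) x 1) dp; rewrite add0r.
  have d2 := @is_deriveV R _ x _ 1 (lt0r_neq0 (p0 x)) d1.
  have := is_deriveB (is_derive_cst (1 : R) x 1) d2.
  by rewrite sub0r scaleNr opprK.
have fi : mu.-integrable `]0, +oo[ (EFin \o f).
  apply: (@integrable_derive_gt0 _ f F 1) => // [x x0|x x0|x x0].
  - apply: cvgM; last by apply: cvgM; [exact: cvg_cst|exact: cpow].
    apply: cvgV; first by rewrite expf_neq0// gt_eqF.
    have c1 : (1 + y `^ r) @[y --> x] --> 1 + x `^ r.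
      by apply: cvgD; [exact: cvg_cst|exact: cpow].
    by under eq_cvg do rewrite expr2; rewrite expr2; exact: cvgM.
  - by rewrite /f mulr_ge0 ?invr_ge0 ?exprn_ge0 ?ltW// mulr_gt0// powR_gt0.
  - rewrite /F subr_ge0 invf_le1// lerDl powR_ge0/= gerBl invr_ge0 ltW//.
apply: (@le_integrable_gt0 _ _ (fun x => C ^+ 2 / r * f x)).
- apply: measurable_fun_gt0 => x x0; apply: cvgM; first exact: cpow.
  apply: (@continuous_comp _ _ _ (@GRing.opp R) expR); first exact: opp_continuous.
  exact: continuous_expR.
- move=> x x0; rewrite ger0_norm ?mulr_ge0 ?powR_ge0 ?expR_ge0//.
  have -> : C ^+ 2 / r * f x = x `^ (r - 1) * (C / (1 + x `^ r)) ^+ 2.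
    by rewrite /f; field; rewrite !gt_eqF.
  rewrite ler_wpM2l ?powR_ge0//.
  have -> : - x = (- (x / 2)) * 2%:R by field.
  rewrite expRM_natr lerXn2r ?nnegrE ?expR_ge0 ?divr_ge0// ?(ltW C0) ?(ltW (p0 x))//.
  rewrite ler_pdivlMr// expRN ler_pdivrMl ?expR_gt0// mulrC.
  rewrite /C mulrDl mul1r lerD ?powR_le_expR//.
  by rewrite -expR0 ler_expR divr_ge0// ltW.
- by have := (fun m => @integrableZl _ _ _ _ _ m (C ^+ 2 / r) _ fi) (measurable_itv _).
Qed.

Definition gamma_integrand z x : R[i] := cpow x (z - 1) * (expR (- x))%:C.

Let continuous_Re_gamma w z x : 0 < x ->
  {for x, continuous (fun y => complex.Re (w * gamma_integrand z y))}.
Proof.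
move=> x0.
have -> : (fun y => complex.Re (w * gamma_integrand z y)) =
    (fun y => complex.Re (w * cpow y (z - 1)) * expR (- y)).
  by apply/funext => y; rewrite /gamma_integrand mulrA ReMC.
apply: cvgM; first exact: continuous_Re_cpow.
apply: (@continuous_comp _ _ _ (@GRing.opp R) expR); first exact: opp_continuous.
exact: continuous_expR.
Qed.

Let cmod_gamma z x : 0 < x ->
  cmod (gamma_integrand z x) = x `^ (complex.Re z - 1) * expR (- x).
Proof.
by move=> x0; rewrite cmodM cmod_cpow// cmodC ger0_norm ?expR_ge0// ReB1.
Qed.

Lemma has_cintegral_gamma z : 0 < complex.Re z ->
  has_cintegral (gamma_integrand z) (cGamma z).
Proof.
move=> z0; apply: has_cintegral_dominated (integrable_gamma z0).
- by move=> w x; exact: continuous_Re_gamma.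
- by move=> x x0; rewrite cmod_gamma.
Qed.

(** Integration by parts: z x^(z-1) e^(-x) - x^z e^(-x) is the derivative of
    x^z e^(-x), which vanishes at 0 and at infinity. *)
Lemma cGammaS z : 0 < complex.Re z -> cGamma (z + 1) = z * cGamma z.
Proof.
move=> z0; have z10 : 0 < complex.Re (z + 1) by case: (z) z0 => a b /= a0; rewrite addr_gt0.
have iz := has_cintegralZ z (has_cintegral_gamma z0).
have iS := has_cintegralZ (-1) (has_cintegral_gamma z10).
have := has_cintegralD iz iS.
set phi := (fun x => _) => phiI.
suff phi0 : forall w, (\int[mu]_(x in `]0%R, +oo[) (complex.Re (w * phi x))%:E = 0)%E.
  apply/esym/eqP; rewrite -subr_eq0; apply/eqP/eq_Re => w.
  have [_ e] := phiI w; rewrite phi0 mulN1r in e.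
  by apply: EFin_inj; rewrite -e mulr0.
move=> w.
pose F x := complex.Re (w * cpow x z) * expR (- x).
have phiE x : 0 < x -> complex.Re (w * phi x) =
    complex.Re (w * cpow x z) * (- expR (- x)) +
    expR (- x) * complex.Re (w * (z * cpow x (z - 1))).
  move=> x0; rewrite /phi /gamma_integrand addrK mulN1r mulrDr mulrN ReD.
  have -> : complex.Re (- (w * (cpow x z * (expR (- x))%:C))) =
    - complex.Re (w * cpow x z * (expR (- x))%:C) by rewrite mulrA; case: (_ * _ * _).
  rewrite ReMC (_ : w * (z * _) = w * (z * cpow x (z - 1)) * (expR (- x))%:C).
    by rewrite ReMC; ring.
  by rewrite !mulrA.
have ub x : 0 < x -> `|F x| <= cmod w * (x `^ complex.Re z * expR (- x)).
  move=> x0; rewrite /F normrM (ger0_norm (expR_ge0 _)) mulrA.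
  rewrite ler_wpM2r ?expR_ge0// (le_trans (Re_le_cmod _))// cmodM.
  by rewrite cmod_cpow.
apply: (@integral_derive_gt0 _ _ F).
- move=> x x0; rewrite /phi.
  have -> : (fun y => complex.Re
      (w * (z * gamma_integrand z y + -1 * gamma_integrand (z + 1) y))) =
    (fun y => complex.Re (w * z * gamma_integrand z y) +
      complex.Re (- w * gamma_integrand (z + 1) y)).
    by apply/funext => y; rewrite mulrDr ReD mulrA mulN1r mulrN mulNr.
  by apply: cvgD; exact: continuous_Re_gamma.
- by have [] := phiI w.
- move=> x x0; rewrite phiE//.
  have de : is_derive x 1 (fun y : R => expR (- y)) (- expR (- x)).
    have dn : is_derive x 1 (@GRing.opp R) (-1) by apply: is_deriveN.
    by apply: (is_derive_eq (is_derive1_comp (is_derive_expR _) dn)); rewrite mulrN1.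
  have dc := is_derive_Re_cpow w z x0.
  by apply: (is_derive_eq (is_deriveM dc de)).
- have lim0 : cmod w * (n.+1%:R^-1 `^ complex.Re z) @[n --> \oo] --> (0 : R).
    rewrite -(mulr0 (cmod w)); apply: cvgM; first exact: cvg_cst.
    have /cvg_at_rightP := powR_cvg0 z0; apply; split; last exact: cvg_harmonic.
    by move=> n; rewrite invr_gt0.
  apply: norm_cvg0; apply: squeeze_cvgr (cvg_cst 0) lim0; apply: nearW => n.
  have n0 : 0 < n.+1%:R^-1 :> R by rewrite invr_gt0.
  rewrite normr_ge0/= (le_trans (ub _ n0))// ler_wpM2l ?cmod_ge0//.
  by rewrite ler_piMr ?powR_ge0// -expR0 ler_expR oppr_le0 ltW.
- pose K := cmod w * ((2 * complex.Re z) `^ complex.Re z * 2).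
  have limy : K * n.+1%:R^-1 @[n --> \oo] --> (0 : R).
    rewrite -(mulr0 K); apply: cvgM; first exact: cvg_cst.
    exact: cvg_harmonic.
  apply: norm_cvg0; apply: squeeze_cvgr (cvg_cst 0) limy; apply: nearW => n.
  have n0 : 0 < n.+1%:R :> R by [].
  rewrite normr_ge0/= (le_trans (ub _ n0))// /K -[leRHS]mulrA ler_wpM2l ?cmod_ge0//.
  apply: (@le_trans _ _ ((2 * complex.Re z) `^ complex.Re z * expR (n.+1%:R / 2) *
    expR (- n.+1%:R))).
    by rewrite ler_wpM2r ?expR_ge0// powR_le_expR.
  rewrite -!mulrA ler_wpM2l ?powR_ge0// -expRD.
  have -> : n.+1%:R / 2 - n.+1%:R = - (n.+1%:R / 2) :> R by field.
  rewrite expRN -[leRHS]invf_div lef_pV2 ?posrE ?expR_gt0 ?divr_gt0//.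
  by rewrite (le_trans _ (expR_ge1Dx _))// lerDr.
Qed.

Lemma cGamma_pochhammer z k : 0 < complex.Re z ->
  cGamma (z + k%:R) = pochhammer z k * cGamma z.
Proof.
move=> z0; elim: k => [|k IH]; first by rewrite /pochhammer big_ord0 mul1r addr0.
rewrite -natr1 addrA cGammaS; last first.
  have -> : k%:R = (k%:R : R)%:C by rewrite rmorph_nat.
  by rewrite ReD/= ltr_pwDl.
by rewrite IH /pochhammer big_ord_recr/= mulrCA mulrA mulrC mulrA.
Qed.

(** Its integral in x is Gamma(z) / c^z; c / x is the integrand of Gamma seen
    from the variable 1 / x. *)
Definition inv_gamma_integrand c z x : R[i] :=
  cpow x (- z - 1) * (expR (- (c / x)))%:C.

Lemma continuous_Re_inv_gamma c z w x : 0 < x ->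
  {for x, continuous (fun y => complex.Re (w * inv_gamma_integrand c z y))}.
Proof.
move=> x0.
have -> : (fun y => complex.Re (w * inv_gamma_integrand c z y)) =
    (fun y => complex.Re (w * cpow y (- z - 1)) * expR (- (c / y))).
  by apply/funext => y; rewrite /inv_gamma_integrand mulrA ReMC.
apply: cvgM; first exact: continuous_Re_cpow.
apply: (@continuous_comp _ _ _ (fun y : R => - (c / y)) expR); last exact: continuous_expR.
apply: cvgN; apply: cvgM; first exact: cvg_cst.
by apply: cvgV; rewrite ?gt_eqF.
Qed.

Lemma inv_gamma_subst c z x : 0 < c -> 0 < x ->
  inv_gamma_integrand c z (c / x) * (c / x ^+ 2)%:C =
  cpow c (- z) * gamma_integrand z x.
Proof.
move=> c0 x0; rewrite /inv_gamma_integrand /gamma_integrand.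
have -> : c / (c / x) = x by rewrite invf_div mulrC divfK// gt_eqF.
rewrite cpowM ?invr_gt0// cpowV// opprB opprK.
have -> : cpow c (- z) = cpow c (- z - 1) * c%:C.
  by rewrite -[c in c%:C]expr1 -cpow_nat// -cpowD subrK.
have -> : cpow x (1 + z) = cpow x (z - 1) * (x ^+ 2)%:C.
  by rewrite -cpow_nat// -cpowD; congr cpow; ring.
have x20 : (x ^+ 2)%:C != 0 by rewrite fmorph_eq0 expf_neq0// gt_eqF.
rewrite [(c / x ^+ 2)%:C]fmorph_div/=.
move: (cpow _ _) (cpow _ _) (expR _) x20 => u v e.
by move: ((x ^+ 2)%:C) c%:C e%:C => X C E X0; field.
Qed.

Lemma has_cintegral_inv_gamma c z : 0 < c -> 0 < complex.Re z ->
  has_cintegral (inv_gamma_integrand c z) (cGamma z / cpow c z).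
Proof.
move=> c0 z0 w.
pose f y := complex.Re (w * inv_gamma_integrand c z y).
have cf x : 0 < x -> {for x, continuous f} by exact: continuous_Re_inv_gamma.
have [gi gI] := has_cintegral_gamma z0 (w * cpow c (- z)).
have fE x : 0 < x -> f (c / x) * (c / x ^+ 2) =
    complex.Re (w * cpow c (- z) * gamma_integrand z x).
  by move=> x0; rewrite -mulrA -inv_gamma_subst// mulrA ReMC.
split.
  apply/integrableP; split; first by apply/measurable_EFinP; apply: (@measurable_fun_gt0 _ f).
  rewrite (_ : (\int[mu]_(x in `]0%R, +oo[) _)%E =
    (\int[mu]_(x in `]0%R, +oo[) (`|f x|)%:E)%E)//.
  rewrite (integral_divl_gt0 c0); last first.
    by move=> x x0; apply: cvg_norm; exact: cf.
  have /integrableP[_] := gi; congr (_ < _)%E; apply: eq_integral => x.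
  rewrite inE/= in_itv/= andbT => x0; rewrite -fE// normrM.
  by congr (_ * _)%:E; rewrite ger0_norm// ltW// divr_gt0// exprn_gt0.
rewrite (integral_divl_gt0 c0 cf).
transitivity (\int[mu]_(x in `]0%R, +oo[)
    (complex.Re (w * cpow c (- z) * gamma_integrand z x))%:E)%E.
  by apply: eq_integral => x; rewrite inE/= in_itv/= andbT => x0; rewrite -fE.
by rewrite gI cpowN mulrAC -!mulrA.
Qed.

Lemma cmod_inv_gamma c z x : 0 < x ->
  (cmod (inv_gamma_integrand c z x))%:C = inv_gamma_integrand c (complex.Re z)%:C x.
Proof.
move=> x0; rewrite /inv_gamma_integrand cmodM cmod_cpow// cmodC ger0_norm ?expR_ge0//.
have -> : - (complex.Re z)%:C - 1 = (- complex.Re z - 1)%:C by rewrite rmorphB rmorphN.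
rewrite cpow_real// -rmorphM/= ReB1; congr ((_ `^ (_ - 1) * _)%:C).
by case: (z).
Qed.

End gamma.

(** * Abel's limit theorem *)

Section abel.
Context {R : realType}.
Implicit Types (u : nat -> R) (U r : R).

Lemma geometric_sumE r n : (1 - r) * (\sum_(0 <= k < n) r ^+ k) = 1 - r ^+ n.
Proof. by rewrite big_mkord -opprB mulNr -subrX1 opprB. Qed.

(** Summation by parts, with U subtracted from the partial sums so that the
    differences S k - U become small. *)
Lemma abel_summation u U r n :
  let S n := \sum_(0 <= k < n) u k in
  \sum_(0 <= k < n) u k * r ^+ k - U =
  (1 - r) * (\sum_(0 <= k < n) (S k.+1 - U) * r ^+ k) + (S n - U) * r ^+ n.
Proof.
move=> S; elim: n => [|n IH].
  by rewrite /S !big_geq//; ring.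
have SS : S n.+1 = S n + u n by rewrite /S big_nat_recr.
rewrite big_nat_recr//= [in RHS]big_nat_recr//= addrAC IH SS exprS.
by ring.
Qed.

Lemma abel_limit u U (V : R -> R) :
  \sum_(0 <= k < n) u k @[n --> \oo] --> U ->
  (forall r, 0 < r < 1 ->
    \sum_(0 <= k < n) u k * r ^+ k @[n --> \oo] --> V r) ->
  V r @[r --> 1^'-] --> U.
Proof.
move=> uU uV; pose S n := \sum_(0 <= k < n) u k.
apply/cvgrPdist_le => e e0.
have e20 : 0 < e / 2 by rewrite divr_gt0.
have e40 : 0 < e / 2 / 2 by rewrite divr_gt0.
move/cvgrPdist_le : uU => /(_ _ e40) [N _ NS].
(* beyond N the partial sums are e/4-close to U; the first N contribute at most
   (1 - r) * M, which is small for r near 1 *)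
pose M := \sum_(0 <= k < N) `|S k.+1 - U|.
have M0 : 0 <= M by apply: sumr_ge0.
have bound r n : 0 < r < 1 -> (N <= n)%N ->
    `|\sum_(0 <= k < n) u k * r ^+ k - U| <= (1 - r) * M + e / 2.
  move=> /andP[r0 r1] Nn; rewrite abel_summation.
  have r10 : 0 <= 1 - r by rewrite subr_ge0 ltW.
  have SU k : (N <= k)%N -> `|S k - U| <= e / 2 / 2.
    by move=> Nk; rewrite distrC; exact: NS.
  apply: (le_trans (ler_normD _ _)).
  rewrite (_ : _ + e / 2 = ((1 - r) * M + e / 2 / 2) + e / 2 / 2); last by field.
  apply: lerD; last first.
    rewrite normrM -[leRHS]mulr1 ler_pM//; first exact: SU.
    by rewrite normrX ger0_norm ?exprn_ile1 ?ltW.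
  rewrite normrM (ger0_norm r10).
  have : \sum_(0 <= k < n) `|(S k.+1 - U) * r ^+ k| <=
      M + e / 2 / 2 * \sum_(0 <= k < n) r ^+ k.
    rewrite (big_cat_nat (n := N))//= mulr_sumr.
    rewrite [X in _ <= _ + X](big_cat_nat (n := N))//=.
    rewrite addrA lerD//.
      rewrite -[leLHS]addr0 lerD//.
        apply: ler_sum => k _; rewrite normrM normrX (ger0_norm (ltW r0)).
        by rewrite ler_piMr// exprn_ile1 ?ltW.
      by apply: sumr_ge0 => k _; rewrite mulr_ge0 ?exprn_ge0 ?ltW.
    rewrite !big_nat; apply: ler_sum => k /andP[Nk _].
    rewrite normrM normrX (ger0_norm (ltW r0)); apply: ler_wpM2r.
      by rewrite exprn_ge0 ?ltW.
    by apply: (SU k.+1); exact: leqW.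
  move=> /(ler_wpM2l r10); rewrite mulrDr mulrCA geometric_sumE => h.
  apply: (le_trans (ler_wpM2l r10 (ler_norm_sum _ _ _))).
  apply: (le_trans h); rewrite lerD2l -[leRHS]mulr1 (ler_wpM2l (ltW e40))//.
  by rewrite gerBl exprn_ge0 ?ltW.
have limV r : 0 < r < 1 -> `|U - V r| <= (1 - r) * M + e / 2.
  move=> r01; rewrite distrC.
  have : `|\sum_(0 <= k < n) u k * r ^+ k - U| @[n --> \oo] --> `|V r - U|.
    by apply: cvg_norm; apply: cvgB; [exact: uV|exact: cvg_cst].
  move/cvgr_to_le; apply; exists N => // n Nn; exact: bound.
near=> r.
apply: (le_trans (limV r _)).
  apply/andP; split; near: r; [|exact: nbhs_left_lt].
  by apply: nbhs_left_gt.
have : (1 - r) * M <= e / 2.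
  have : 1 - e / 2 / (M + 1) < r.
    by near: r; apply: nbhs_left_gt; rewrite ltrBlDr ltrDl divr_gt0// ltr_wpDl.
  rewrite ltrBlDr -ltrBlDl ltr_pdivlMr ?ltr_wpDl// => h.
  apply: le_trans (ltW h); rewrite ler_wpM2l//.
    by rewrite subr_ge0 ltW//; near: r; exact: nbhs_left_lt.
  by rewrite lerDl.
by move=> h; rewrite [leRHS](splitr e) lerD2r.
Unshelve. all: by end_near. Qed.

End abel.

(** * Complex series *)

Section series.
Context {R : realType}.
Implicit Types (e h : nat -> R[i]) (r c x : R) (w z : R[i]).

(** The series with terms e has sum z, stated on real parts for the same reason
    as [has_cintegral]. *)
Definition has_csum e z := forall w,
  complex.Re (w * \sum_(0 <= k < n) e k) @[n --> \oo] --> complex.Re (w * z).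

Lemma has_csum_cvg e : cvgn (series (e : nat -> R[i]^o)) ->
  has_csum e (limn (series (e : nat -> R[i]^o))).
Proof. by move=> ce w; exact: (@cvg_Re _ (series (e : nat -> R[i]^o)) _ w ce). Qed.

Lemma bounded_has_csum e z : has_csum e z -> exists M, forall k, cmod (e k) <= M.
Proof.
move=> ez.
have bRe w : exists M, forall k, `|complex.Re (w * e k)| <= M.
  have cw : cvgn (series (fun k => complex.Re (w * e k))).
    apply/cvg_ex; exists (complex.Re (w * z)); apply: cvg_trans (ez w).
    by apply: near_eq_cvg; apply: nearW => n; rewrite /series/= mulr_sumr Re_sum.
  have /cvg_series_cvg_0 /cvgP /cvg_seq_bounded [M [_ hM]] := cw.
  by exists (M + 1) => k; apply: hM => //; rewrite ltrDl.
have [M1 h1] := bRe 1; have [M2 h2] := bRe (- 'i).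
exists (M1 + M2) => k; have := lerD (h1 k) (h2 k); rewrite mul1r -ImE.
apply: le_trans; rewrite [X in cmod X]complexE (le_trans (cmodD _ _))//.
rewrite cmodC cmodM cmodC (_ : cmod 'i = 1) ?mul1r//.
by rewrite /cmod normc_def/= expr0n/= add0r expr1n sqrtr1.
Qed.

Lemma nneseries_le (u : nat -> R) (M : R) : (forall k, 0 <= u k) ->
  (forall n, \sum_(0 <= k < n) u k <= M) ->
  (\sum_(0 <= k <oo) (u k)%:E < +oo)%E.
Proof.
move=> u0 uM; apply: (@le_lt_trans _ _ M%:E); last exact: ltry.
apply: lime_le; first by apply: is_cvg_nneseries => k _ _; rewrite lee_fin.
by apply: nearW => n; rewrite sumEFin lee_fin.
Qed.

Lemma sum_expr_le r n : 0 < r < 1 -> \sum_(0 <= k < n) r ^+ k <= (1 - r)^-1.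
Proof.
move=> /andP[r0 r1]; have r10 : 0 < 1 - r by rewrite subr_gt0.
rewrite -[leRHS]mul1r ler_pdivlMr// mulrC geometric_sumE gerBl exprn_ge0//.
exact: ltW.
Qed.

(** Bounded terms at one point of a power series give absolute convergence at
    all points closer to 0; r is the ratio of the two points. *)
Lemma bounded_abs_summable e M r : (forall k, cmod (e k) <= M) -> 0 < r < 1 ->
  (\sum_(0 <= k <oo) (cmod (e k) * r ^+ k)%:E < +oo)%E.
Proof.
move=> eM r01; have /andP[r0 r1] := r01.
have M0 : 0 <= M by rewrite (le_trans _ (eM 0%N))// cmod_ge0.
apply: (@nneseries_le _ (M * (1 - r)^-1)) => [k|n].
  by rewrite mulr_ge0 ?cmod_ge0// exprn_ge0// ltW.
apply: (@le_trans _ _ (\sum_(0 <= k < n) M * r ^+ k)).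
  by apply: ler_sum => k _; rewrite ler_wpM2r// exprn_ge0// ltW.
by rewrite -mulr_sumr ler_wpM2l// sum_expr_le.
Qed.

Lemma bounded_has_csum_geometric e M r : (forall k, cmod (e k) <= M) ->
  0 < r < 1 -> exists z, has_csum (fun k => e k * (r ^+ k)%:C) z.
Proof.
move=> eM r01; have /andP[r0 r1] := r01.
have cw w : cvgn (series (fun k => complex.Re (w * e k) * r ^+ k)).
  apply: normed_cvg; apply: (@nondecreasing_is_cvgn _ _).
    by apply: nondecreasing_series => k _ _; exact: normr_ge0.
  exists (cmod w * M * (1 - r)^-1) => _ [n _ <-].
  rewrite /series/=; apply: (@le_trans _ _ (\sum_(0 <= k < n) (cmod w * M) * r ^+ k)).
    apply: ler_sum => k _; rewrite normrM (ger0_norm (exprn_ge0 _ (ltW r0))).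
    rewrite ler_wpM2r ?exprn_ge0 ?(ltW r0)// (le_trans (Re_le_cmod _))// cmodM.
    by rewrite ler_wpM2l ?cmod_ge0.
  rewrite -mulr_sumr ler_wpM2l ?sum_expr_le// mulr_ge0 ?cmod_ge0//.
  by rewrite (le_trans _ (eM 0%N))// cmod_ge0.
pose p := limn (series (fun k => complex.Re (1 * e k) * r ^+ k)).
pose q := limn (series (fun k => complex.Re (- 'i * e k) * r ^+ k)).
exists (p +i* q) => w; rewrite ReM/=.
have : complex.Re w * series (fun k => complex.Re (1 * e k) * r ^+ k) n -
    complex.Im w * series (fun k => complex.Re (- 'i * e k) * r ^+ k) n
    @[n --> \oo] --> complex.Re w * p - complex.Im w * q.
  by apply: cvgB; (apply: cvgM; [exact: cvg_cst|exact: cw]).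
apply: cvg_trans; apply: near_eq_cvg; apply: nearW => n.
rewrite /series/= [w * _]mulr_sumr Re_sum !mulr_sumr -sumrB; apply: eq_bigr => k _.
by rewrite mulrA ReMC mul1r -ImE ReM; ring.
Qed.

End series.

(** * Termwise integration *)

Section termwise.
Context {R : realType}.
Local Notation mu := (@lebesgue_measure R).
Implicit Types (h : nat -> R[i]) (r c x : R) (w z b : R[i]).

(** Factor by factor, Re b + k = Re (b + k) <= |b + k|.  Integrating absolute
    values yields rising factorials of Re b, whereas the hypergeometric series
    involves those of b. *)
Lemma pochhammer_Re_le b k : 0 < complex.Re b ->
  exists2 p : R, pochhammer (complex.Re b)%:C k = p%:C & 0 <= p <= cmod (pochhammer b k).
Proof.
move=> b0; elim: k => [|k [p pE /andP[p0 pb]]].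
  by exists 1; rewrite /pochhammer ?big_ord0// cmodC normr1 lexx ler01.
have Rebk : complex.Re (b + k%:R) = complex.Re b + k%:R.
  have -> : k%:R = (k%:R : R)%:C by rewrite rmorph_nat.
  by rewrite ReD.
have bk0 : 0 <= complex.Re b + k%:R by rewrite addr_ge0// ltW.
exists (p * (complex.Re b + k%:R)).
  rewrite /pochhammer big_ord_recr/= -/(pochhammer _ _) pE rmorphM rmorphD/=.
  by rewrite rmorph_nat.
rewrite mulr_ge0//= /pochhammer big_ord_recr/= -/(pochhammer _ _) cmodM ler_pM//.
by rewrite -Rebk (le_trans (ler_norm _))// Re_le_cmod.
Qed.

Lemma inv_gammaD c b k x : 0 < x ->
  inv_gamma_integrand c (b + k%:R) x = inv_gamma_integrand c b x * (x^-1 ^+ k)%:C.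
Proof.
move=> x0; rewrite /inv_gamma_integrand.
have -> : - (b + k%:R) - 1 = (- b - 1) + - k%:R by ring.
by rewrite cpowD -cpowV// cpow_nat ?invr_gt0// mulrAC.
Qed.

(** The k-th moment of the kernel in 1 / x: this is where each term of the series
    acquires the factor (b)_k. *)
Lemma inv_gamma_constE c b k : 0 < c -> 0 < complex.Re b ->
  cGamma (b + k%:R) / cpow c (b + k%:R) =
  cGamma b / cpow c b * (pochhammer b k * (c^-1 ^+ k)%:C).
Proof.
move=> c0 b0; rewrite cGamma_pochhammer// cpowD invfM -cpowN -[(cpow c k%:R)^-1]cpowN.
by rewrite -[cpow c (- k%:R)]cpowV// cpow_nat ?invr_gt0//; ring.
Qed.

(** Dominated convergence for the partial sums, dominated by the sum of the
    absolute values of the terms.  The integral of the absolute value of the k-th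
    term is an inverse gamma integral with parameter Re b + k, that is
    (Re b)_k / c^k up to a constant, so it is bounded by the k-th term of the
    absolutely convergent series of the hypothesis. *)
Lemma has_cintegral_termwise h b c (F : R -> R[i]) z :
  0 < c -> 0 < complex.Re b ->
  (forall x, 0 < x -> has_csum (fun k => h k * (x^-1 ^+ k)%:C) (F x)) ->
  (\sum_(0 <= k <oo) (cmod (h k * pochhammer b k) * c^-1 ^+ k)%:E < +oo)%E ->
  has_csum (fun k => h k * pochhammer b k * (c^-1 ^+ k)%:C) z ->
  has_cintegral (fun x => inv_gamma_integrand c b x * F x)
    (cGamma b / cpow c b * z).
Proof.
move=> c0 b0 hF habs hz.
have bk0 k : 0 < complex.Re (b + k%:R).
  have -> : k%:R = (k%:R : R)%:C by rewrite rmorph_nat.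
  by rewrite ReD/= ltr_pwDl.
pose phi k x := h k * inv_gamma_integrand c (b + k%:R) x.
pose I k := h k * (cGamma (b + k%:R) / cpow c (b + k%:R)).
have phiI k : has_cintegral (phi k) (I k).
  exact/has_cintegralZ/has_cintegral_inv_gamma.
pose g x := (\sum_(0 <= k <oo) (cmod (phi k x))%:E)%E.
have g_integrable : mu.-integrable `]0, +oo[ g.
  pose B := (complex.Re b)%:C : R[i].
  have B0 : 0 < complex.Re B by [].
  have Bk0 k : 0 < complex.Re (B + k%:R).
    have -> : k%:R = (k%:R : R)%:C by rewrite rmorph_nat.
    by rewrite ReD/= ltr_pwDl.
  pose psi k x := complex.Re ((cmod (h k))%:C * inv_gamma_integrand c (B + k%:R) x).
  have psiE k x : 0 < x -> cmod (phi k x) = psi k x.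
    move=> x0; rewrite /phi cmodM /psi [_%:C * _]mulrC ReMC mulrC; congr (_ * _).
    have <- : (complex.Re (b + k%:R))%:C = B + k%:R.
      have -> : k%:R = (k%:R : R)%:C by rewrite rmorph_nat.
      by rewrite ReD rmorphD.
    by rewrite -(cmod_inv_gamma c (b + k%:R) x0).
  (* absolute values of the terms are again inverse gamma integrands *)
  have [psi_i psi_I] : (forall k, mu.-integrable `]0, +oo[ (EFin \o psi k)) /\
      (forall k, (\int[mu]_(x in `]0%R, +oo[) (psi k x)%:E =
        (complex.Re ((cmod (h k))%:C * (cGamma (B + k%:R) / cpow c (B + k%:R))))%:E)%E).
    by split=> k; have [] := has_cintegral_inv_gamma c0 (Bk0 k) (cmod (h k))%:C.
  have mphi k : measurable_fun (`]0, +oo[%classic : set R) (fun x => (cmod (phi k x))%:E).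
    have /integrableP[+ _] := psi_i k; apply: eq_measurable_fun => x.
    by rewrite inE/= in_itv/= andbT => x0; rewrite psiE.
  have phi0 k x : `]0, +oo[%classic x -> (0 <= (cmod (phi k x))%:E)%E.
    by rewrite lee_fin cmod_ge0.
  apply/integrableP; split.
    apply: (@ge0_emeasurable_sum _ _ _ _ (fun k x => (cmod (phi k x))%:E) xpredT).
      by move=> k x Dx _; exact: phi0 Dx.
    by move=> k _; exact: mphi.
  have -> : (\int[mu]_(x in `]0%R, +oo[) `|g x| = \int[mu]_(x in `]0%R, +oo[) g x)%E.
    apply: eq_integral => x _; rewrite gee0_abs//; apply: nneseries_ge0 => k _ _.
    by rewrite lee_fin cmod_ge0.
  have -> := (fun m => @integral_nneseries _ _ _ mu _ m _ mphi phi0) (measurable_itv _).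
  pose G0 := complex.Re (cGamma B / cpow c B).
  apply: (@le_lt_trans _ _
    (\sum_(0 <= k <oo) (`|G0|%:E * (cmod (h k * pochhammer b k) * c^-1 ^+ k)%:E))%E).
    apply: lee_nneseries => [k _ _|k _]; first by apply: integral_ge0 => x; exact: phi0.
    have -> : (\int[mu]_(x in `]0%R, +oo[) (cmod (phi k x))%:E =
        \int[mu]_(x in `]0%R, +oo[) (psi k x)%:E)%E.
      by apply: eq_integral => x; rewrite inE/= in_itv/= andbT => x0; rewrite psiE.
    rewrite psi_I inv_gamma_constE// /B.
    have [p -> /andP[p0 pb]] := pochhammer_Re_le k b0.
    rewrite -rmorphM -/B mulrA ReMC [_%:C * _]mulrC ReMC -/G0 -EFinM lee_fin cmodM.
    have q0 : 0 <= cmod (h k) * c^-1 ^+ k.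
      by rewrite mulr_ge0 ?cmod_ge0// exprn_ge0// invr_ge0 ltW.
    rewrite (_ : G0 * _ * _ = cmod (h k) * c^-1 ^+ k * (G0 * p)); last by ring.
    rewrite [leRHS](_ : _ = cmod (h k) * c^-1 ^+ k *
      (`|G0| * cmod (pochhammer b k))); last by ring.
    by rewrite ler_wpM2l// (le_trans (ler_wpM2r p0 (ler_norm G0)))// ler_wpM2l.
  rewrite nneseriesZl; last first.
    by move=> k _; rewrite lee_fin mulr_ge0 ?cmod_ge0// exprn_ge0// invr_ge0 ltW.
  by rewrite lte_mul_pinfty.
apply: (@has_cintegral_lim _ (fun n x => \sum_(0 <= k < n) phi k x)
  (fun n => \sum_(0 <= k < n) I k) _ _ g).
- by move=> n; exact: has_cintegral_sum.
- move=> w x x0; rewrite mulrA; apply: cvg_trans (hF x x0 (w * inv_gamma_integrand c b x)).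
  apply: near_eq_cvg; apply: nearW => n; congr complex.Re.
  rewrite -mulrA; congr (_ * _); rewrite mulr_sumr; apply: eq_bigr => k _.
  by rewrite /phi inv_gammaD//; ring.
- move=> n x x0; apply: (@le_trans _ _ (\sum_(0 <= k < n) (cmod (phi k x))%:E)%E).
    by rewrite sumEFin lee_fin cmod_sum.
  by apply: nneseries_lim_ge => k _ _; rewrite lee_fin cmod_ge0.
- exact: g_integrable.
- move=> w; rewrite mulrA; apply: cvg_trans (hz (w * (cGamma b / cpow c b))).
  apply: near_eq_cvg; apply: nearW => n; congr complex.Re.
  rewrite -mulrA; congr (_ * _); rewrite mulr_sumr; apply: eq_bigr => k _.
  by rewrite /I inv_gamma_constE//; ring.
Qed.

End termwise.

(** * Mixtures of inverse gamma kernels and hypergeometric functions *)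

Section hypergeometric.
Context {R : realType}.
Local Notation mu := (@lebesgue_measure R).
Implicit Types (A B : seq R[i]) (c r x : R) (w y z : R[i]).

(** A nonnegative integrand is real, so the imaginary part of the integral
    vanishes and its real part is an ordinary integral. *)
Lemma has_cintegral_ge0 (phi : R -> R[i]) z : has_cintegral phi z ->
  (forall x, 0 < x -> 0 <= phi x) ->
  0 <= z /\ (\int[mu]_(x in `]0%R, +oo[) (complex.Re (phi x))%:E = (complex.Re z)%:E)%E.
Proof.
move=> phiz phi0.
have [_ rez] := phiz 1; have [_ imz] := phiz (- 'i).
have intE : (\int[mu]_(x in `]0%R, +oo[) (complex.Re (phi x))%:E = (complex.Re z)%:E)%E.
  by rewrite -[in RHS](mul1r z) -rez; apply: eq_integral => x _; rewrite mul1r.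
split=> //; apply/complex_ge0P; split.
  rewrite ImE; apply: EFin_inj; rewrite -imz.
  rewrite integral0_eq// => x; rewrite /= in_itv/= andbT => x0.
  by have /complex_ge0P[im0 _] := phi0 x x0; rewrite -ImE im0.
rewrite -lee_fin -intE; apply: integral_ge0 => x; rewrite /= in_itv/= andbT => x0.
by have /complex_ge0P[_] := phi0 x x0; rewrite lee_fin.
Qed.

Definition hyp_coef A B k : R[i] :=
  (\prod_(a <- A) pochhammer a k) / (\prod_(b <- B) pochhammer b k) / k`!%:R.

Lemma hyp_termE A B y k : hyp_term A B y k = hyp_coef A B k * y ^+ k.
Proof. by rewrite /hyp_term /hyp_coef mulrA mulrAC. Qed.

Lemma hyp_coef_rcons A B z k :
  hyp_coef (rcons A z) B k = hyp_coef A B k * pochhammer z k.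
Proof. by rewrite /hyp_coef big_rcons/=; ring. Qed.

Lemma has_csum_pFq A B y : hyp_convergent A B y ->
  has_csum (fun k => hyp_coef A B k * y ^+ k) (pFq A B y).
Proof.
move=> /has_csum_cvg; rewrite -/(pFq A B y).
by have -> : (fun k => hyp_coef A B k * y ^+ k) = hyp_term A B y
  by apply/funext => k; rewrite hyp_termE.
Qed.

Variables (A B : seq R[i]) (b : R[i]) (upsilon xi : R).
Hypotheses (xi_gt0 : 0 < xi) (b_gt0 : 0 < complex.Re b).
Hypothesis cvgA : forall x, 0 < x -> hyp_convergent A B (upsilon / x)%:C.
Hypothesis cvg_xi : hyp_convergent (rcons A b) B (upsilon * xi^-1)%:C.

(** [h] are the coefficients of pFq at upsilon / x as a power series in 1 / x,
    and [e] the terms of the p+1Fq series at upsilon / xi. *)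
Let h k : R[i] := hyp_coef A B k * (upsilon ^+ k)%:C.
Let e k : R[i] := h k * pochhammer b k * (xi^-1 ^+ k)%:C.

Let h_hyp c k : h k * pochhammer b k * (c^-1 ^+ k)%:C =
  hyp_coef (rcons A b) B k * (upsilon * c^-1)%:C ^+ k.
Proof. by rewrite /h hyp_coef_rcons -rmorphXn/= exprMn rmorphM/=; ring. Qed.

Let has_csum_e : has_csum e (pFq (rcons A b) B (upsilon * xi^-1)%:C).
Proof.
have -> : e = fun k => hyp_coef (rcons A b) B k * (upsilon * xi^-1)%:C ^+ k.
  by apply/funext => k; exact: h_hyp.
exact: has_csum_pFq.
Qed.

Definition mixture_integrand c x :=
  inv_gamma_integrand c b x * pFq A B (upsilon / x)%:C.

(** Convergence of the p+1Fq series at upsilon / xi bounds its terms, which makes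
    it converge absolutely at upsilon / c. *)
Let has_cintegral_mixture_gen c z : xi < c ->
  has_csum (fun k => h k * pochhammer b k * (c^-1 ^+ k)%:C) z ->
  has_cintegral (mixture_integrand c) (cGamma b / cpow c b * z).
Proof.
move=> xic hz; have c0 : 0 < c := lt_trans xi_gt0 xic.
have [M eM] := bounded_has_csum has_csum_e.
apply: (@has_cintegral_termwise R h b c (fun x => pFq A B (upsilon / x)%:C) z
  c0 b_gt0 _ _ hz).
- move=> x x0; have := has_csum_pFq (cvgA x0).
  have -> // : (fun k => hyp_coef A B k * (upsilon / x)%:C ^+ k) =
      fun k => h k * (x^-1 ^+ k)%:C.
  by apply/funext => k; rewrite /h -rmorphXn/= exprMn rmorphM/= mulrA.
- have r01 : 0 < xi / c < 1 by rewrite divr_gt0//= ltr_pdivrMr// mul1r.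
  rewrite (@eq_eseriesr _ _ (fun k => (cmod (e k) * (xi / c) ^+ k)%:E)).
    exact: bounded_abs_summable eM r01.
  move=> k _.
  rewrite /e [in RHS]cmodM cmodC ger0_norm ?exprn_ge0 ?invr_ge0 ?(ltW xi_gt0)//.
  by rewrite -mulrA -exprMn mulKf// gt_eqF.
Qed.

Lemma has_cintegral_mixture c : xi < c ->
  hyp_convergent (rcons A b) B (upsilon * c^-1)%:C ->
  has_cintegral (mixture_integrand c)
    (cGamma b / cpow c b * pFq (rcons A b) B (upsilon * c^-1)%:C).
Proof.
move=> xic cc; apply: (has_cintegral_mixture_gen xic).
have -> : (fun k => h k * pochhammer b k * (c^-1 ^+ k)%:C) =
    fun k => hyp_coef (rcons A b) B k * (upsilon * c^-1)%:C ^+ k.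
  by apply/funext => k; exact: h_hyp.
exact: has_csum_pFq cc.
Qed.

(** The value at c = xi is not treated as an integral, since the series may
    converge only conditionally there.  With c = xi / r and r in (0, 1), the terms
    of the series are [e k * r ^+ k], so by Abel's theorem the values at xi / r,
    which are integrals of nonnegative functions, tend to the value at xi. *)
Lemma mixture_ge0_boundary C :
  (forall c x, xi < c -> 0 < x -> 0 <= C * mixture_integrand c x) ->
  0 <= C * (cGamma b / cpow xi b * pFq (rcons A b) B (upsilon * xi^-1)%:C).
Proof.
move=> C0; have [M eM] := bounded_has_csum has_csum_e.
have [Phi PhiP] : exists Phi : R -> R[i], forall r, 0 < r < 1 ->
    has_csum (fun k => e k * (r ^+ k)%:C) (Phi r).
  have /choice[Phi PhiP] r : exists z, 0 < r < 1 ->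
      has_csum (fun k => e k * (r ^+ k)%:C) z.
    have [r01|nr01] := boolP (0 < r < 1); last by exists 0.
    by have [z hz] := bounded_has_csum_geometric eM r01; exists z.
  by exists Phi.
set Phi0 := pFq _ _ _; pose D := C * (cGamma b / cpow xi b).
have Q_ge0 r : 0 < r < 1 -> 0 <= D * Phi r * cpow r b.
  move=> r01; have /andP[r0 r1] := r01.
  have xic : xi < xi / r by rewrite ltr_pdivlMr// gtr_pMr.
  have hz : has_csum (fun k => h k * pochhammer b k * ((xi / r)^-1 ^+ k)%:C) (Phi r).
    have := PhiP r r01; congr has_csum; apply/funext => k.
    by rewrite /e -mulrA -rmorphM/= -exprMn invf_div [r / xi]mulrC.
  have := has_cintegralZ C (has_cintegral_mixture_gen xic hz).
  case/has_cintegral_ge0 => [x x0|+ _]; first exact: C0.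
  have -> // : C * (cGamma b / cpow (xi / r) b * Phi r) = D * Phi r * cpow r b.
  by rewrite cpowM ?invr_gt0// cpowV// cpowN invfM invrK /D; ring.
have PhiPhi0 w : complex.Re (w * Phi r) @[r --> 1^'-] --> complex.Re (w * Phi0).
  apply: (abel_limit (u := fun k => complex.Re (w * e k))).
    have := @has_csum_e w; apply: cvg_trans; apply: near_eq_cvg; apply: nearW => n.
    by rewrite mulr_sumr Re_sum.
  move=> r r01; have := PhiP r r01 w; apply: cvg_trans; apply: near_eq_cvg.
  apply: nearW => n; rewrite mulr_sumr Re_sum; apply: eq_bigr => k _.
  by rewrite mulrA ReMC.
have cpow1 w : complex.Re (w * cpow r b) @[r --> 1^'-] --> complex.Re (w * 1).
  have c1 : cpow (1 : R) b = 1 by rewrite /cpow ln1 mulr0 expC0.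
  rewrite -[in X in _ --> X]c1.
  by apply: cvg_at_left_filter; exact: (@continuous_Re_cpow R w 1 b ltr01).
(* Re (u v) = Re u Re v - Im u Im v reduces the limit of the product to the two
   previous ones *)
have lim w : complex.Re (w * (D * Phi r * cpow r b)) @[r --> 1^'-] -->
    complex.Re (w * (D * Phi0)).
  have -> : complex.Re (w * (D * Phi0)) =
      complex.Re (w * D * Phi0) * complex.Re (1 * 1 : R[i]) -
      complex.Re (- 'i * w * D * Phi0) * complex.Re (- 'i * 1 : R[i]).
    by rewrite !mul1r !mulr1/= oppr0 mulr0 subr0 mulrA.
  have : complex.Re (w * D * Phi r) * complex.Re (1 * cpow r b) -
      complex.Re (- 'i * w * D * Phi r) * complex.Re (- 'i * cpow r b) @[r --> 1^'-]
      --> complex.Re (w * D * Phi0) * complex.Re (1 * 1 : R[i]) -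
      complex.Re (- 'i * w * D * Phi0) * complex.Re (- 'i * 1 : R[i]).
    by apply: cvgB; (apply: cvgM; [exact: PhiPhi0|exact: cpow1]).
  apply: cvg_trans; apply: near_eq_cvg; apply: nearW => r.
  have -> : w * (D * Phi r * cpow r b) = w * D * Phi r * cpow r b by ring.
  by rewrite [complex.Re (w * D * Phi r * cpow r b)]ReM -!(mulrA (- 'i)) -!ImE mul1r.
rewrite mulrA -/D; apply/complex_ge0P; split.
- rewrite ImE; apply: (cvg_unique _ (lim (- 'i))) => //.
  have : cst (0 : R) r @[r --> (1 : R)^'-] --> (0 : R) by exact: cvg_cst.
  apply: cvg_trans; apply: near_eq_cvg; near=> r; rewrite -ImE.
  have /Q_ge0 /complex_ge0P[] // : 0 < r < 1.
  by apply/andP; split; near: r; [exact: nbhs_left_gt|exact: nbhs_left_lt].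
- have := lim 1; rewrite mul1r => /cvgr_to_ge; apply; near=> r; rewrite mul1r.
  have /Q_ge0 /complex_ge0P[] // : 0 < r < 1.
  by apply/andP; split; near: r; [exact: nbhs_left_gt|exact: nbhs_left_lt].
Unshelve. all: by end_near. Qed.

End hypergeometric.

(** * Densities of mixtures *)

Section densities.
Context {R : realType}.

(** By uniqueness g is almost everywhere the Radon-Nikodym derivative of nu, for
    which the change of measure is known. *)
Lemma ge0_integral_density d (T : measurableType d)
    (nu : {finite_measure set T -> \bar R}) (mu : {sigma_finite_measure set T -> \bar R})
    (g : T -> R) (f : T -> \bar R) :
  measurable_fun setT g -> (forall x, 0 <= g x) ->
  (forall B, measurable B -> nu B = \int[mu]_(x in B) (g x)%:E)%E ->
  measurable_fun setT f -> (forall x, 0 <= f x)%E ->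
  (\int[nu]_x f x = \int[mu]_x (f x * (g x)%:E))%E.
Proof.
move=> mg g0 nuE mf f0.
have dom : nu `<< mu.
  apply/null_content_dominatesP => A mA muA0; rewrite nuE//.
  by apply: null_set_integral => //; apply/measurable_EFinP; exact: measurable_funTS.
rewrite -(Radon_Nikodym_SigmaFinite.change_of_variables dom f0 measurableT mf).
have fi := Radon_Nikodym_SigmaFinite.f_integrable dom.
apply: ae_eq_integral => //.
- by apply: emeasurable_funM => //; exact: measurable_int fi.
- by apply: emeasurable_funM => //; exact/measurable_EFinP.
apply: ae_eqe_mul2l; apply: integral_ae_eq => //.
  by apply/measurable_EFinP.
by move=> E _ mE; rewrite -Radon_Nikodym_SigmaFinite.f_integral// nuE.
Qed.

Section mixture.
Context {d} {Omega : measurableType d} (P : probability Omega R).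
Context {d2} {T2 : measurableType d2} (nu : {sigma_finite_measure set T2 -> \bar R}).
Variables (S : {RV P >-> measurableTypeR R}) (X : {RV P >-> T2}).
Variables (g : R -> R[i]) (f k : R -> T2 -> R).
Hypothesis hS : has_density S lebesgue_measure g.
Hypothesis g_le0 : forall s, s <= 0 -> g s = 0.
Hypothesis hX : has_conditional_density S X nu f.
Hypothesis fk : forall s x, 0 < s -> f s x = k s x.
Hypothesis k_ge0 : forall s x, 0 <= k s x.
Hypothesis mk : measurable_fun setT (fun p : measurableTypeR R * T2 => k p.1 p.2).

Let D : set (measurableTypeR R) := `]0, +oo[%classic.

Let mD : measurable D. Proof. exact: measurable_itv. Qed.

Let Re_g_ge0 s : 0 <= complex.Re (g s).
Proof. by have [/(_ s)/complex_ge0P[]] := hS. Qed.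

Let m_Re_g : measurable_fun (setT : set (measurableTypeR R)) (fun s => complex.Re (g s)).
Proof. by have [] := hS. Qed.

Let mkg : measurable_fun setT
  (fun p : measurableTypeR R * T2 => (k p.1 p.2 * complex.Re (g p.1))%:E).
Proof.
apply/measurable_EFinP; apply: measurable_funM => //.
exact: (measurableT_comp m_Re_g measurable_fst).
Qed.

(** The conditional density f is only controlled where s > 0; the kernel k agrees
    with it there and is jointly measurable everywhere, as Tonelli's theorem
    requires.  For s <= 0 the factor g s vanishes. *)
Definition mixture_pdf x : \bar R :=
  (\int[lebesgue_measure]_s (k s x * complex.Re (g s))%:E)%E.

Lemma mixture_pdf_half_line x : mixture_pdf x =
  (\int[lebesgue_measure]_(s in `]0%R, +oo[) (k s x * complex.Re (g s))%:E)%E.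
Proof.
rewrite /mixture_pdf [RHS]integral_mkcond; apply: eq_integral => s _.
rewrite patchE; case: ifPn => //; rewrite notin_setE/= in_itv/= andbT => /negP.
by rewrite -leNgt => /g_le0 ->; rewrite mulr0.
Qed.

Lemma measurable_mixture_pdf : measurable_fun setT mixture_pdf.
Proof.
apply: (measurable_fun_fubini_tonelli_G
  (fun p : measurableTypeR R * T2 => (k p.1 p.2 * complex.Re (g p.1))%:E)) => //.
by move=> p; rewrite lee_fin mulr_ge0.
Qed.

Let S_le0 : P (S @^-1` (~` D)) = 0%E.
Proof.
have [_ _ /(_ (~` D) (measurableC mD))] := hS.
rewrite /distribution /pushforward => ->.
apply: integral0_eq => s; rewrite /D /= in_itv/= andbT => /negP.
by rewrite -leNgt => /g_le0 ->.
Qed.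

(** Restrict to the almost sure event S > 0, replace f by k, write the law of S
    with its density and exchange the integrals. *)
Lemma mixture_density (B : set T2) : measurable B ->
  distribution P X B = (\int[nu]_(x in B) mixture_pdf x)%E.
Proof.
move=> mB.
have mXB : measurable (X @^-1` B).
  by rewrite -[X in measurable X]setTI; exact: measurable_funPT.
have mS A : measurable A -> measurable (S @^-1` A).
  by move=> mA; rewrite -[X in measurable X]setTI; exact: measurable_funPT.
have -> : distribution P X B = P (S @^-1` D `&` X @^-1` B).
  rewrite /distribution /pushforward.
  have {1}-> : X @^-1` B =
      (S @^-1` D `&` X @^-1` B) `|` (S @^-1` (~` D) `&` X @^-1` B).
    by rewrite -setIUl -preimage_setU setUCr preimage_setT setTI.
  rewrite measureU; [|exact: measurableI (mS _ mD) mXB|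
    exact: measurableI (mS _ (measurableC mD)) mXB|]; last first.
    by rewrite setIACA -preimage_setI setICr preimage_set0 set0I.
  rewrite [X in (_ + X)%E](_ : _ = 0%E) ?adde0//.
  apply: (subset_measure0 _ _ _ S_le0); [| |exact: subIsetl].
  - exact: measurableI (mS _ (measurableC mD)) mXB.
  - exact: mS (measurableC mD).
rewrite hX//.
pose K s x := (k s x * \1_B x)%:E.
have mK : measurable_fun setT (fun p : measurableTypeR R * T2 => K p.1 p.2).
  apply/measurable_EFinP; apply: measurable_funM => //.
  apply: (measurableT_comp _ measurable_snd).
  exact: measurable_indic.
have K0 p : (0 <= K p.1 p.2)%E by rewrite lee_fin mulr_ge0.
pose Phi s := (\int[nu]_x K s x)%E.
have PhiE s : D s -> (\int[nu]_(x in B) (f s x)%:E)%E = Phi s.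
  rewrite /D /= in_itv/= andbT => s0; rewrite integral_mkcond; apply: eq_integral => x _.
  rewrite patchE /K indicE; case: ifPn => xB; first by rewrite fk// mulr1.
  by rewrite mulr0.
have mPhi : measurable_fun [set: measurableTypeR R] Phi.
  exact: (measurable_fun_fubini_tonelli_F (fun p : measurableTypeR R * T2 => K p.1 p.2)).
have Phi0 s : (0 <= Phi s)%E by apply: integral_ge0 => x _; exact: (K0 (s, x)).
transitivity (\int[distribution P S]_(s in D) Phi s)%E.
  by apply: eq_integral => s; rewrite inE => /PhiE.
rewrite integral_mkcond.
rewrite (@ge0_integral_density _ _ (distribution P S) (@lebesgue_measure R)
  (fun s => complex.Re (g s)))//; last first.
- by move=> s; rewrite patchE; case: ifP.
- by apply/(measurable_restrictT _ mD); exact: measurable_funTS.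
- by have [_ _ h] := hS; exact: h.
transitivity (\int[lebesgue_measure]_s \int[nu]_x (K s x * (complex.Re (g s))%:E))%E.
  apply: eq_integral => s _; rewrite patchE; case: ifPn => [sD|].
    rewrite ge0_integralZr ?lee_fin//; last by move=> x _; exact: (K0 (s, x)).
    exact: (measurableT_comp mK (pair1_measurable s)).
  rewrite notin_setE/D/= in_itv/= andbT => /negP; rewrite -leNgt => /g_le0 ->.
  by rewrite mul0e integral0_eq// => x _; rewrite mule0.
rewrite (fubini_tonelli (fun p : measurableTypeR R * T2 =>
  K p.1 p.2 * (complex.Re (g p.1))%:E)%E)/=.
- rewrite [RHS]integral_mkcond; apply: eq_integral => x _.
  rewrite patchE; case: ifPn => xB.
    by apply: eq_integral => s _; rewrite /K indicE xB mulr1 EFinM.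
  by apply: integral0_eq => s _; rewrite /K indicE (negbTE xB) mulr0 mul0e.
- apply: emeasurable_funM => //; apply/measurable_EFinP.
  exact: (measurableT_comp m_Re_g measurable_fst).
- by move=> p; apply: mule_ge0; [exact: (K0 p)|rewrite lee_fin].
Qed.

End mixture.
End densities.

(** * The inverted hypergeometric gamma scale mixture *)

Section scale_mixture.
Context {R : realType}.
Implicit Types (s c tau : R).
Variables (A B : seq R[i]) (a : R[i]) (M N upsilon xi : R).

(** With N the normalizing constant, M = mn/2 and tau = t(x) / 2, this
    is the normal density at x with covariance scaled by s > 0.  The power -1
    keeps it measurable in s on the whole line. *)
Definition scale_kernel tau s : R :=
  N * (s `^ (- M) * expR (- (tau * s `^ (-1)))).

Definition scale_const : R[i] :=
  N%:C * (cpow xi a / (cGamma a * pFq (rcons A a) B (upsilon / xi)%:C)).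

(** Conjugacy: the kernel shifts a to a + M and xi to xi + tau. *)
Lemma scale_kernelE tau s : 0 < s ->
  (scale_kernel tau s)%:C * inv_hyp_gamma_pdf A B a upsilon xi s =
  scale_const * mixture_integrand A B (a + M%:C) upsilon (xi + tau) s.
Proof.
move=> s0; rewrite /inv_hyp_gamma_pdf s0 /mixture_integrand /inv_gamma_integrand.
have -> : - (a + M%:C) - 1 = (- a - 1) + (- M)%:C by rewrite rmorphN/=; ring.
rewrite [cpow s (_ + (- M)%:C)]cpowD cpow_real//.
have -> : expR (- ((xi + tau) / s)) = expR (- (xi / s)) * expR (- (tau * s `^ (-1))).
  by rewrite -expRD powR_inv1 ?ltW// mulrDl opprD.
by rewrite /scale_kernel /scale_const !rmorphM/=; ring.
Qed.

End scale_mixture.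

Lemma quad_tr_center (R : realType) n m (mu : 'M[R]_(n, m)) Sigma Theta :
  quad_tr mu Sigma Theta mu = 0.
Proof. by rewrite /quad_tr subrr mulmx0 mxtrace0. Qed.

Unset Implicit Arguments.

Theorem theorem6p1 (R : realType) (m n : nat) (hm : (0 < m)%N) (hn : (0 < n)%N)
    (Sigma : 'M[R]_m) (hSigma : posdefmx Sigma)
    (Theta : 'M[R]_n) (hTheta : posdefmx Theta)
    (mu : 'M[R]_(n, m))
    (upsilon xi : R) (hupsilon : 0 < upsilon) (hxi : 0 < xi)
    (p q : nat) (A : p.-tuple R[i]) (B : q.-tuple R[i])
    (a : R[i]) (ha : 0 < complex.Re a)
    (t : 'M[R]_(n, m) -> R) (ht : t = quad_tr mu Sigma Theta)
    (hB : hyp_well_defined B)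
    (hcvg_S : forall s : R, 0 < s -> hyp_convergent A B (upsilon / s)%:C)
    (hcvg_c : hyp_convergent (rcons A a) B (upsilon / xi)%:C)
    (hcvg_X : forall x : 'M[R]_(n, m),
       hyp_convergent (rcons A (a + ((m * n)%:R / 2)%:C)) B
         (upsilon * (xi + 2^-1 * t x)^-1)%:C)
    (d : measure_display) (Omega : measurableType d) (P : probability Omega R)
    (S : {RV P >-> measurableTypeR R}) (X : {RV P >-> 'M[R]_(n, m)})
    (hS : has_density S lebesgue_measure
            (inv_hyp_gamma_pdf A B a upsilon xi))
    (hX : has_conditional_density S X (@lebesgue_mx R n m)
            (fun s => matrix_normal_pdf mu (s *: Sigma) Theta)) :
  left_spherical_elliptical mu Sigma Theta X /\
  has_density X (@lebesgue_mx R n m) (fun x =>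
    cGamma (a + ((m * n)%:R / 2)%:C) * cpow xi a /
      (((2 * pi) `^ ((m * n)%:R / 2))%:C * cGamma a *
       ((\det Sigma) `^ (n%:R / 2))%:C * ((\det Theta) `^ (m%:R / 2))%:C *
       pFq (rcons A a) B (upsilon / xi)%:C) *
    (pFq (rcons A (a + ((m * n)%:R / 2)%:C)) B
         (upsilon * (xi + 2^-1 * t x)^-1)%:C /
     cpow (xi + 2^-1 * t x) (a + ((m * n)%:R / 2)%:C))).
Proof.
pose M : R := (m * n)%:R / 2; pose b := a + M%:C.
pose dS := (\det Sigma) `^ (n%:R / 2); pose dT := (\det Theta) `^ (m%:R / 2).
pose N := ((2 * pi) `^ M * dS * dT)^-1.
pose C := scale_const A B a N upsilon xi.
pose val c := C * (cGamma b / cpow c b * pFq (rcons A b) B (upsilon * c^-1)%:C).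
pose c x := xi + 2^-1 * t x.
pose k s x := scale_kernel M N (2^-1 * t x) s.
have b0 : 0 < complex.Re b by rewrite ReD/= ltr_pwDl// divr_ge0.
have N0 : 0 <= N by rewrite invr_ge0 !mulr_ge0// powR_ge0.
have t0 x : 0 <= t x by rewrite ht quad_tr_ge0.
have tmu : t mu = 0 by rewrite ht quad_tr_center.
have cmu : c mu = xi by rewrite /c tmu mulr0 addr0.
have mt : measurable_fun setT t by rewrite ht; exact: measurable_quad_tr.
have cvg_xi : hyp_convergent (rcons A b) B (upsilon * xi^-1)%:C.
  by have := hcvg_X mu; rewrite -/(c mu) cmu.
have kernel_ge0 tau s : 0 <= scale_kernel M N tau s.
  by rewrite mulr_ge0// mulr_ge0 ?powR_ge0// expR_ge0.
have g0 s : 0 <= inv_hyp_gamma_pdf A B a upsilon xi s by have [] := hS.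
have integrand_ge0 tau s : 0 < s ->
    0 <= C * mixture_integrand A B b upsilon (xi + tau) s.
  by move=> s0; rewrite -scale_kernelE// mulr_ge0// ler0c.
(* away from mu one has c x > xi and the series may be integrated termwise *)
have integral_val x : x != mu -> 0 <= val (c x) /\
    mixture_pdf (inv_hyp_gamma_pdf A B a upsilon xi) k x =
      (complex.Re (val (c x)))%:E.
  move=> xmu; have xic : xi < c x.
    rewrite /c ltrDl mulr_gt0// lt_neqAle t0 andbT eq_sym.
    by apply: contra_neq xmu => tx0; apply: (quad_tr_eq0 hSigma hTheta); rewrite -ht.
  have := has_cintegral_mixture hxi b0 hcvg_S cvg_xi xic (hcvg_X x).
  move=> /(has_cintegralZ C) /has_cintegral_ge0[s s0|v0 vE]; first exact: integrand_ge0.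
  split=> //; rewrite -vE mixture_pdf_half_line; last first.
    by move=> s s0; rewrite /inv_hyp_gamma_pdf ltNge s0.
  apply: eq_integral => s; rewrite inE/= in_itv/= andbT => s0.
  by rewrite -scale_kernelE// mulrC [_%:C * _]mulrC ReMC.
have val_mu : 0 <= val xi.
  apply: (mixture_ge0_boundary hxi b0 hcvg_S cvg_xi) => c' s xic s0.
  by rewrite -(subrK xi c') addrC; exact: integrand_ge0.
have val_ge0 x : 0 <= val (c x).
  by have [->|/integral_val[]//] := eqVneq x mu; rewrite cmu.
have mk : measurable_fun setT (fun z : measurableTypeR R * 'M[R]_(n, m) => k z.1 z.2).
  have ms r : measurable_fun setT (fun z : measurableTypeR R * 'M[R]_(n, m) => z.1 `^ r).
    exact: (measurableT_comp (@measurable_powR R r) measurable_fst).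
  apply: measurable_funM => //; apply: measurable_funM => //.
  apply: (measurableT_comp (@measurable_expR R)).
  apply: (measurableT_comp (@oppr_measurable R setT)).
  apply: measurable_funM => //; apply: measurable_funM => //.
  exact: (measurableT_comp mt measurable_snd).
have fk s x : 0 < s -> matrix_normal_pdf mu (s *: Sigma) Theta x = k s x.
  move=> s0; rewrite matrix_normal_pdf_scale// /k /scale_kernel ht.
  by rewrite powR_inv1 ?ltW.
have gle0 s : s <= 0 -> inv_hyp_gamma_pdf A B a upsilon xi s = 0.
  by move=> s0; rewrite /inv_hyp_gamma_pdf ltNge s0.
have k0 s x : 0 <= k s x by exact: kernel_ge0.
have mpdf := measurable_mixture_pdf hS k0 mk.
(* at the single point mu the value is not known to be the mixture integral *)
have mval : measurable_fun setT (fun x => complex.Re (val (c x))).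
  have -> : (fun x => complex.Re (val (c x))) = (fun x =>
      if x == mu then complex.Re (val xi)
      else fine (mixture_pdf (inv_hyp_gamma_pdf A B a upsilon xi) k x)).
    apply/funext => x; have [->|xmu] := eqVneq x mu; first by rewrite cmu.
    by have [_ ->] := integral_val x xmu.
  apply: measurable_fun_ifT => //.
    apply: (measurable_fun_bool true); rewrite setTI.
    rewrite (_ : _ @^-1` _ = [set mu]); first exact: measurable_set1_mx.
    by apply/seteqP; split=> x /eqP.
  by apply: (measurableT_comp _ mpdf); exact: fine_measurable.
have density : has_density X (@lebesgue_mx R n m) (fun x => val (c x)).
  split=> // E mE.
  rewrite (mixture_density hS gle0 hX fk k0 mk mE).
  apply: ae_eq_integral => //.
  - exact: measurable_funTS.
  - by apply/measurable_EFinP; exact: measurable_funTS.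
  exists [set mu]; split; [exact: measurable_set1_mx|exact: lebesgue_mx_set1|].
  move=> x /=; apply: contra_notP => xmu _.
  by have [|_ ->] := integral_val x; first exact/eqP.
have formulaE z : cGamma b * cpow xi a /
      (((2 * pi) `^ M)%:C * cGamma a * dS%:C * dT%:C *
       pFq (rcons A a) B (upsilon / xi)%:C) *
    (pFq (rcons A b) B (upsilon * z^-1)%:C / cpow z b) = val z.
  by rewrite /val /C /scale_const /N fmorphV/= !rmorphM/= !invfM; ring.
split; last first.
  by under eq_fun do rewrite -/M -/b -/dS -/dT formulaE; exact: density.
(* the constant 1 is divided by the determinant factors dS * dT, so h restores
   them *)
exists 1, (fun W => dS * dT * complex.Re (val (xi + 2^-1 * \tr W))).
have -> // : (fun x => (1 / (dS * dT) * (dS * dT * complex.Re (val (xi + 2^-1 *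
    \tr (invmx (sqrtmx Sigma) *m (x - mu)^T *m invmx Theta *m (x - mu) *m
      invmx (sqrtmx Sigma))))))%:C) = (fun x => val (c x)).
apply/funext => x; rewrite quad_tr_sqrtmx// -ht -/(c x) mul1r mulKf.
  by have := val_ge0 x; case: (val _) => u v /complex_ge0P[/= -> _].
by rewrite mulf_neq0// gt_eqF// powR_gt0// posdefmx_det_gt0.
Qed.
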